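(* Let $(K,\nu)$ be a henselian valued field with $\operatorname{char} K=0$ and $\operatorname{char} K\nu=p>0$, and let $(K(\theta)|K,\nu)$ be a purely wild extension. Suppose that the minimal polynomial of $\theta$ over $K$ is of the form $f(X)=\mathfrak{A}(X)-c$, where $c\in K$ and $$\mathfrak{A}(X)=\sum_{i=0}^{n} a_i X^{p^i}\in\mathcal{O}_K[X].$$ Suppose that $\nu a_0=\nu a_n=0$, that $\nu\theta>-\frac{\nu p}{p^n}$, and that $K\nu$ is not $\mathfrak{A}\nu$-closed. Then $(K,\nu)$ does not admit a unique maximal purely wild extension. If moreover $(K(\theta)|K,\nu)$ is an immediate extension, then $(K,\nu)$ does not admit a unique maximal immediate algebraic extension.
   Context: Valuations are Krull valuations of arbitrary rank, written additively; expressions such as $\frac{\nu p}{p^n}$ are taken in the divisible hull of the value group. For a valued field $(K,\nu)$: $\mathcal{O}_K$ is the valuation ring, $\nu K$ the value group, $K\nu$ the residue field; for $g\in\mathcal{O}_K[X]$, $g\nu\in K\nu[X]$ is the polynomial obtained by reducing coefficients. $(K,\nu)$ is henselian if $\nu$ extends uniquely to the algebraic closure $K^{\mathrm{ac}}$; every algebraic extension of $K$ carries this unique extension, again denoted $\nu$. For henselian $(K,\nu)$ with $\operatorname{char}K\nu=p>0$, an algebraic extension $(L|K,\nu)$ is purely wild if $\nu L/\nu K$ is a $p$-group and $L\nu|K\nu$ is purely inseparable. An extension $(L|K,\nu)$ is immediate if $\nu L=\nu K$ and $L\nu=K\nu$. A maximal purely wild (resp. maximal immediate algebraic) extension of $K$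 is a purely wild (resp. immediate algebraic) extension inside $K^{\mathrm{ac}}$ not properly contained in another such extension of $K$. ''$(K,\nu)$ does not admit a unique'' such maximal extension means that there exist two of them that are not isomorphic over $K$ by a valuation preserving isomorphism. A field $k$ is not $g$-closed, for $g\in k[X]$, if $g(k)\subsetneq k$, i.e. there is $d\in k$ such that $g(X)-d$ has no root in $k$. *)

(* Defs.v *)
From HB Require Import structures.
From mathcomp Require Import all_boot all_order all_algebra.
From mathcomp Require Import ring_quotient generic_quotient.
From mathcomp Require Import boolp classical_sets functions.

Set Implicit Arguments.
Unset Strict Implicit.
Unset Printing Implicit Defensive.

Import Order.TTheory GRing.Theory.
Local Open Scope ring_scope.
Local Open Scope quotient_scope.

(* Totally ordered abelian groups; no rank or archimedean condition. *)
HB.mixin Record isOrderedAbGroup G of Num.POrderedZmodule G := {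
  oag_le_total : total (<=%O : rel G);
  oag_leD2l : forall z x y : G, (x <= y)%O -> (z + x <= z + y)%O
}.

#[short(type="oagType")]
HB.structure Definition OrderedAbGroup :=
  { G of isOrderedAbGroup G & Num.POrderedZmodule G }.

(* [withoo G] is G together with a largest, absorbing element oo = None. *)
Definition withoo (G : Type) : Type := option G.
Definition Fin {G : Type} (g : G) : withoo G := Some g.
Definition oo {G : Type} : withoo G := None.

Section WithInfinity.
Variable G : oagType.
Implicit Types x y z : withoo G.

HB.instance Definition _ := Choice.copy (withoo G) (option G).

Definition oo_le x y : bool :=
  match x, y with
  | _, None => true
  | None, Some _ => false
  | Some a, Some b => (a <= b)%O
  end.

Definition oo_add x y : withoo G :=
  match x, y with
  | Some a, Some b => Some (a + b)
  | _, _ => None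
  end.

Fact oo_le_refl : reflexive oo_le.
Proof. by case=> //= a. Qed.

Fact oo_le_anti : antisymmetric oo_le.
Proof. by move=> [a|] [b|] //= /le_anti ->. Qed.

Fact oo_le_trans : transitive oo_le.
Proof. by move=> [b|] [a|] [c|] //=; apply: le_trans. Qed.

Fact oo_le_total : total oo_le.
Proof. by move=> [a|] [b|] //=; apply: oag_le_total. Qed.

HB.instance Definition _ := Order.Le_isPOrder.Build ring_display (withoo G)
  oo_le_refl oo_le_anti oo_le_trans.
HB.instance Definition _ :=
  Order.POrder_isTotal.Build ring_display (withoo G) oo_le_total.

Fact oo_addA : associative oo_add.
Proof. by move=> [a|] [b|] [c|] //=; rewrite addrA. Qed.

Fact oo_addC : commutative oo_add.
Proof. by move=> [a|] [b|] //=; rewrite addrC. Qed.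

Fact oo_add0 : left_id (Some 0 : withoo G) oo_add.
Proof. by move=> [a|] //=; rewrite add0r. Qed.

HB.instance Definition _ :=
  GRing.isNmodule.Build (withoo G) oo_addA oo_addC oo_add0.

End WithInfinity.

(* Krull valuations.  The value group is the set of finite values of v, which
   may be a proper subgroup of G. *)
Record valuation (F : fieldType) (G : oagType) := Valuation {
  valuation_fun :> F -> withoo G;
  val_eqoo : forall x, (valuation_fun x == oo) = (x == 0);
  valM : forall x y, valuation_fun (x * y) = valuation_fun x + valuation_fun y;
  valD : forall x y,
    (Order.min (valuation_fun x) (valuation_fun y) <= valuation_fun (x + y))%O
}.

Section ResidueField.
Variables (F : fieldType) (G : oagType) (v : valuation F G).
Implicit Types x y : F.

Lemma val0 : v 0 = oo.
Proof. by apply/eqP; rewrite val_eqoo. Qed.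

Lemma val1 : v 1 = 0.
Proof.
have := valM v 1 1; rewrite mulr1.
have := val_eqoo v 1; rewrite oner_eq0.
case: (v 1) => [a|] //= _ [] /(congr1 (fun t => t - a)).
by rewrite subrr addrK => <-.
Qed.

Lemma valN1 : v (- 1) = 0.
Proof.
have := valM v (-1) (-1); rewrite mulrNN mulr1 val1.
case: (v (-1)) => [a|] // [] e.
suff -> : a = 0 by [].
apply/eqP; rewrite eq_le; apply/andP.
have aE : a = - a by apply/eqP; rewrite -addr_eq0 -e.
have [le0|le0] := orP (oag_le_total a 0); have := oag_leD2l (- a) _ _ le0;
  by rewrite addNr addr0 -aE; split.
Qed.

Lemma valN x : v (- x) = v x.
Proof. by rewrite -mulN1r valM valN1 add0r. Qed.

Lemma valB_ge0 x y : ((0 : withoo G) <= v x)%O -> ((0 : withoo G) <= v y)%O -> ((0 : withoo G) <= v (x - y))%O.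
Proof.
move=> x0 y0; apply: le_trans (valD v _ _).
by rewrite le_min x0 valN y0.
Qed.

Lemma valB_gt0 x y : ((0 : withoo G) < v x)%O -> ((0 : withoo G) < v y)%O -> ((0 : withoo G) < v (x - y))%O.
Proof.
move=> x0 y0; apply: lt_le_trans (valD v _ _).
by rewrite lt_min x0 valN y0.
Qed.

Lemma oo_addr_ge0 (a b : withoo G) :
  ((0 : withoo G) <= a)%O -> ((0 : withoo G) <= b)%O ->
  ((0 : withoo G) <= a + b)%O.
Proof.
case: a b => [a|] [b|] // a0 b0.
by apply: le_trans (a0 : (0 <= a)%O) _; rewrite -[leLHS]addr0; apply: oag_leD2l.
Qed.

Lemma oo_addr_gt0 (a b : withoo G) :
  ((0 : withoo G) <= a)%O -> ((0 : withoo G) < b)%O ->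
  ((0 : withoo G) < a + b)%O.
Proof.
move=> a0 b0; rewrite lt_neqAle oo_addr_ge0 ?(ltW b0) // andbT.
apply/eqP; case: a b a0 b0 => [a|] [b|] // a0 /andP[_ b0] [] e.
have : (a + b <= a + 0)%O by rewrite -e addr0.
move/(oag_leD2l (- a) _ _); rewrite !addKr => b0'.
by case/negP: b0.
Qed.

Lemma valM_ge0 x y : ((0 : withoo G) <= v x)%O -> ((0 : withoo G) <= v y)%O -> ((0 : withoo G) <= v (x * y))%O.
Proof. by rewrite valM; apply: oo_addr_ge0. Qed.

Definition in_valring : pred F := fun x => ((0 : withoo G) <= v x)%O.

Fact in_valring_subring : subring_closed in_valring.
Proof.
split; first by rewrite unfold_in val1.
- by move=> x y; apply: valB_ge0.
- by move=> x y; apply: valM_ge0.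
Qed.

HB.instance Definition _ :=
  GRing.isSubringClosed.Build F in_valring in_valring_subring.

Record valring := Valring { valring_val : F; _ : valring_val \in in_valring }.
HB.instance Definition _ := [isSub for valring_val].
HB.instance Definition _ := [Choice of valring by <:].
HB.instance Definition _ := [SubChoice_isSubComNzRing of valring by <:].

Definition maxideal : pred valring := fun u => ((0 : withoo G) < v (val u))%O.

Fact maxideal_closed : idealr_closed maxideal.
Proof.
split.
- by rewrite unfold_in /= val0.
- by rewrite unfold_in /= val1 ltxx.
- move=> a x y x0 y0; rewrite unfold_in rmorphD rmorphM /=.
  rewrite -[val y]opprK; apply: valB_gt0; last by rewrite valN.
  by rewrite valM; apply: oo_addr_gt0 => //; apply: (valP a).
Qed.

HB.instance Definition _ := isIdealr.Build valring maxideal maxideal_closed.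

Definition maxidealr : idealr valring := maxideal.
Definition residue : Type := {ideal_quot maxidealr}.
HB.instance Definition _ := GRing.ComNzRing.on residue.
HB.instance Definition _ := EqQuotient.on residue.

(* Reduction, with junk value 0 outside the valuation ring. *)
Definition res x : residue := \pi_{ideal_quot maxidealr} (insubd (0 : valring) x).

Definition residue_inv (r : residue) : residue :=
  if r == 0 then 0 else res (val (repr r))^-1.

Fact residue_inv0 : residue_inv 0 = 0.
Proof. by rewrite /residue_inv eqxx. Qed.

Fact residue_mulVf (r : residue) : r != 0 -> residue_inv r * r = 1.
Proof.
move=> r0; rewrite /residue_inv (negPf r0).
set a := repr r; have ra : r = \pi_{ideal_quot maxidealr} a by rewrite reprK.
have va0 : v (val a) = 0.
  apply/eqP; rewrite eq_le (valP a : ((0 : withoo G) <= v (val a))%O) andbT leNgt.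
  apply: contra r0 => a0; rewrite ra -[0](rmorph0 (\pi_{ideal_quot maxidealr})).
  by rewrite -Quotient.idealrBE subr0.
have a0 : val a != 0 by rewrite -(val_eqoo v) va0.
have va1 : v (val a)^-1 = 0.
  by have := valM v (val a)^-1 (val a); rewrite mulVf // val1 va0 addr0 => <-.
rewrite ra /res -rmorphM -[1](rmorph1 (\pi_{ideal_quot maxidealr})).
congr (\pi_ _ _); apply: val_inj; rewrite rmorphM rmorph1 /=.
rewrite insubdK ?mulVf //; change ((0 : withoo G) <= v (val a)^-1)%O.
by rewrite va1.
Qed.

HB.instance Definition _ :=
  GRing.ComNzRing_isField.Build residue residue_mulVf residue_inv0.

End ResidueField.

Section Extensions.
Variables (K F : fieldType) (iota : {rmorphism K -> F}).

(* Valuations are identified when they have the same valuation ring. *)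
Definition val_extends (G H : oagType) (v : valuation K G) (w : valuation F H) :=
  forall a : K, ((0 : withoo _) <= w (iota a))%O = ((0 : withoo G) <= v a)%O.

Definition val_equiv (G H : oagType) (v : valuation F G) (w : valuation F H) :=
  forall x : F, ((0 : withoo G) <= v x)%O = ((0 : withoo _) <= w x)%O.

Definition is_algebraic := forall x : F, algebraicOver iota x.

(* Intermediate fields of F | K. *)
Definition subext (L : set F) : Prop :=
  GRing.divring_closed [in L] /\ (range iota `<=` L)%classic.

Definition adjoin (t : F) : set F :=
  smallest subext [set t].

(* Minimal polynomial up to a non(0 : withoo G) constant factor (not necessarily monic). *)
Definition is_minpoly (t : F) (f : {poly K}) : Prop :=
  [/\ f != 0, root (map_poly iota f) t &
      forall g : {poly K}, g != 0 -> root (map_poly iota g) t ->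
        (size f <= size g)%N].

Variables (H : oagType) (w : valuation F H).
Implicit Types L M : set F.

(* Value groups and residue fields of subextensions of F, K included (as
   [range iota]), are compared inside those of (F, w). *)
Definition value_group L : set H :=
  [set g | exists2 x, L x & w x = Fin g].

Definition residue_field L : set (residue w) :=
  [set r | exists2 x, L x /\ ((0 : withoo _) <= w x)%O & res w x = r].

Definition purely_wild (p : nat) L : Prop :=
  [/\ subext L,
      forall g, value_group L g ->
        exists m, value_group (range iota) (g *+ (p ^ m)%N) &
      forall r, residue_field L r ->
        exists m, residue_field (range iota) (r ^+ (p ^ m)%N)].

Definition immediate L : Prop :=
  [/\ subext L,
      value_group L = value_group (range iota) &
      residue_field L = residue_field (range iota)].

Definition maximal (P : set F -> Prop) L : Prop :=
  P L /\ forall M, P M -> (L `<=` M)%classic -> M = L.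

(* [s] is a valuation preserving K-isomorphism L -> M; its values outside L are
   irrelevant. *)
Definition val_isomorphic L M : Prop :=
  exists s : F -> F,
    [/\ set_bij L M s,
        {in L &, {morph s : x y / x + y}},
        {in L &, {morph s : x y / x * y}},
        forall a, s (iota a) = iota a &
        {in L, forall x, w (s x) = w x}].

Definition not_unique_maximal (P : set F -> Prop) : Prop :=
  exists L M, [/\ maximal P L, maximal P M & ~ val_isomorphic L M].

End Extensions.

(* [iota : K -> F] is meant to be an algebraic closure of K.  Quantifying over
   the group of values covers every extension of v to F. *)
Definition henselian (K F : fieldType) (iota : {rmorphism K -> F})
    (G : oagType) (v : valuation K G) : Prop :=
  (exists (H : oagType) (w : valuation F H), val_extends iota v w) /\
  (forall (H1 H2 : oagType) (w1 : valuation F H1) (w2 : valuation F H2),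
     val_extends iota v w1 -> val_extends iota v w2 -> val_equiv w1 w2).

Definition poly_closed (k : fieldType) (g : {poly k}) : Prop :=
  forall d : k, exists x : k, g.[x] = d.

(* Main.v *)
From HB Require Import structures.
Require Import Defs.
From mathcomp Require Import all_boot all_order all_algebra.
From mathcomp Require Import zify ring.
From mathcomp Require Import boolp classical_sets functions cardinality.

Set Implicit Arguments.
Unset Strict Implicit.
Unset Printing Implicit Defensive.

Import Order.TTheory GRing.Theory.
Local Open Scope ring_scope.

(** Write [O] for the valuation ring of [w] on the algebraic closure [F] of [K],
    [m] for its maximal ideal and [E] for the set of [K]-endomorphisms of [F].
    Two facts about [E] stand in for ramification theory.  As [K] is henselian,
    every [s] in [E] preserves [O] and [m], since [w \o s] is another extension
    of [v] ([conj_in_valring]).  As the characteristic is 0, an intermediate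
    field [L] consists of the elements fixed by all endomorphisms over [L]
    ([fixed_subext]), so that orbit polynomials descend to [L].

    Choose [d] in the valuation ring of [K] such that the reduction of [A - d]
    has no root in the residue field, and a twin [th'] of [th], that is, a root
    of [A - c - d].  The lower bound on [w th] makes the mixed terms of
    [A (th + y)] small ([addpolyD]): [A] is additive modulo [m] around [th].
    Hence [y = th' - th] is integral, and its residue is a root of the reduction
    of [A - d].

    No purely wild extension contains both [th] and [th']: the residue of [y]
    would be purely inseparable over the residue field of [K], and the equation
    it satisfies has a unit as linear coefficient, which puts it into the
    residue field of [K] itself ([twin_residue_root]).  A maximal extension
    containing [th] has therefore no root of [A - c - d] at all, and is not
    isomorphic over [K] to one that contains [th'].

    What remains is that [K(th')] is as wild as [K(th)]: its values and residues
    already occur in [K(th)] ([twin_bounded]), which settles the purely wild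
    and the immediate case at once.  This has two ingredients.

    First, [E] acts trivially on the residues of [K(th')] ([twin_fixed_mod]).
    Given [s] in [E], additivity shows that [s th' - y] is close to a root [z]
    of [A - c].  Since [E] acts trivially on the residues of [K(th)], the
    endomorphisms over [K(th)] induce on residues everything that [E] induces
    ([lift_residues]); this gives an [i] in [E] with [i th = z] that is trivial on any
    two prescribed residues.  When one of them is the residue of [y], then
    [i th'] and [s th'] are roots of [A - c - d] that agree modulo [m], hence
    equal.  So [s] and [i] agree on [K(th')], and the other residue may be any
    residue of [K(th')].

    Secondly, the conjugates of [y] over [K(th)] have distinct residues.  An
    element of [K(th')] is a polynomial in [y] over [K(th)] of degree less than
    the number of conjugates, and a polynomial over [O] of such a degree which is
    in [m] at all conjugates has all its coefficients in [m].  So the value of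
    the element is the value of a coefficient ([twin_primitive]), and its
    residue, which is the same at all conjugates, is that of the constant
    coefficient. *)

(** * Zorn's lemma and division over subrings *)

Lemma zorn_above (T : Type) (P : set (set T)) (A0 : set T) :
  P A0 ->
  (forall C : set (set T), (C `<=` P)%classic -> (C !=set0)%classic ->
     total_on C subset -> P (\bigcup_(X in C) X)%classic) ->
  exists A, [/\ P A, (A0 `<=` A)%classic &
    forall B, P B -> (A `<=` B)%classic -> B = A].
Proof.
move=> PA0 chainP.
have [C CP Ctot|A [PA maxA]] := @Zorn_bigcup T [set B | P (A0 `|` B)%classic].
  have [->|/set0P C0] := eqVneq C set0.
    by rewrite bigcup_set0 /= setU0.
  have [X CX] := C0; rewrite /=.
  have -> : (A0 `|` \bigcup_(X in C) X =
      \bigcup_(Y in [set A0 `|` X | X in C]) Y)%classic.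
    apply/seteqP; split=> [x [A0x|[Y CY Yx]]|x [_ [Y CY <-] [A0x|Yx]]].
    - by exists (A0 `|` X)%classic; [exists X|left].
    - by exists (A0 `|` Y)%classic; [exists Y|right].
    - by left.
    - by right; exists Y.
  apply: chainP; first by move=> _ [Y CY <-]; apply: CP.
    by exists (A0 `|` X)%classic; exists X.
  move=> _ _ [Y CY <-] [Z CZ <-].
  by have [YZ|ZY] := Ctot _ _ CY CZ; [left|right]; apply: setUS.
exists (A0 `|` A)%classic; split=> // B PB sAB; apply/seteqP; split=> //.
apply: contrapT => nsBA; apply: (maxA B).
  split; first by move=> x Ax; apply: sAB; right.
  by move=> sBA; apply: nsBA => x /sBA; right.
rewrite /= setUidr //; by move=> x A0x; apply: sAB; left.
Qed.

Lemma chain_bigcup2 (T : Type) (C : set (set T)) x y : total_on C subset ->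
  (\bigcup_(X in C) X)%classic x -> (\bigcup_(X in C) X)%classic y ->
  exists X, [/\ C X, X x & X y].
Proof.
move=> Ctot [X CX Xx] [Y CY Yy]; have [XY|YX] := Ctot _ _ CX CY.
  by exists Y; split=> //; apply: XY.
by exists X; split=> //; apply: YX.
Qed.

(** Subrings given by a mere property are packaged so that the generic closure
    lemmas and [polyOver] apply to them. *)
Definition subring_pred (R : nzRingType) (S : {pred R}) (hS : subring_closed S) :
  subringClosed R := HB.pack S (GRing.isSubringClosed.Build R S hS).

(** Division by a monic polynomial never divides in the ring of coefficients; it
    is used over subrings of a product of two fields, where leading
    coefficients need not be invertible. *)
Lemma polyOver_rem_monic (R : comNzRingType) (S : subringClosed R)
    (g q : {poly R}) :
  g \is monic -> g \is a polyOver S -> q \is a polyOver S ->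
  exists q1 r, [/\ q1 \is a polyOver S, r \is a polyOver S,
    (size r < size g)%N & q = q1 * g + r].
Proof.
move=> gm gS; have [m] := ubnP (size q); elim: m q => // m IH q.
rewrite ltnS => sq qS; have [qg|gq] := ltnP (size q) (size g).
  by exists 0, q; rewrite rpred0 mul0r add0r.
pose h := lead_coef q *: 'X^(size q - size g); have hS : h \is a polyOver S.
  by rewrite polyOverZ ?polyOverXn // lead_coefE (polyOverP qS).
have sg : (0 < size g)%N by rewrite size_poly_gt0 monic_neq0.
have [||q1 [r [q1S rS srg e]]] := IH (q - h * g).
- have q0 : (0 < size q)%N by apply: leq_trans gq.
  apply: leq_trans sq; rewrite -[X in (_ < X)%N](prednK q0) ltnS.
  apply/leq_sizeP => j hj.
  rewrite coefB /h -scalerAl coefZ coefXnM ltnNge.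
  have -> : (size q - size g <= j)%N by lia.
  move: hj; rewrite leq_eqVlt => /orP[/eqP <-|hj] /=.
    have -> : ((size q).-1 - (size q - size g) = (size g).-1)%N by lia.
    by rewrite -!lead_coefE (monicP gm) mulr1 subrr.
  have sj : (size q <= j)%N by lia.
  have sj' : (size g <= j - (size q - size g))%N by lia.
  by rewrite (nth_default _ sj) (nth_default _ sj') mulr0 subr0.
- by rewrite rpredB ?rpredM.
exists (q1 + h), r; split => //; first by rewrite rpredD.
by rewrite mulrDl addrAC -e subrK.
Qed.

Definition subfield_pred (K F : fieldType) (iota : {rmorphism K -> F})
    (L : set F) (hL : subext iota L) : divringClosed F :=
  HB.pack [in L] (GRing.isDivringClosed.Build F [in L] hL.1).

(** * Endomorphisms of an algebraic closure *)

Definition fixes (F : fieldType) (L : set F) (s : {rmorphism F -> F}) :=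
  forall x, L x -> s x = x.

Section PartialEndomorphisms.
Variables (K : fieldType) (F : closedFieldType) (iota : {rmorphism K -> F}).
Hypothesis algF : is_algebraic iota.

Local Notation FF := (F * F)%type.
Implicit Types (S : set FF) (L : set F).

(** The graph of a [K]-homomorphism from a subring of [F] to [F].  As a graph of
    this kind is a subring of [F * F], functionality need only be stated at 0,
    and adjoining an element together with its image is evaluating polynomials
    at a point of [F * F]. *)
Definition partial_endo S : Prop :=
  [/\ GRing.subring_closed [in S], forall a, S (iota a, iota a) &
      forall y, S (0, y) -> y = 0].

Section OnePartialEndo.
Variable S : set FF.
Hypothesis hS : partial_endo S.

Let Sr : subringClosed FF := let: And3 h _ _ := hS in subring_pred h.

Lemma partial_endoE u : (u \in Sr) = (u \in S).
Proof. by rewrite /Sr; case: hS. Qed.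

Lemma partial_endoP u : u \in Sr <-> S u.
Proof. by rewrite partial_endoE; split=> [/set_mem|/mem_set]. Qed.

Let Sfun y : S (0, y) -> y = 0.
Proof. by case: hS => _ _; apply. Qed.

Let Siota a : (iota a, iota a) \in Sr.
Proof. by apply/partial_endoP; case: hS. Qed.

Lemma partial_endo_poly (g : {poly K}) u : S u ->
  ((map_poly iota g).[u.1], (map_poly iota g).[u.2]) \in Sr.
Proof.
move=> /partial_endoP Su; elim/poly_ind: g => [|g c IH].
  by rewrite map_poly0 !horner0; apply: rpred0.
rewrite rmorphD rmorphM /= map_polyX map_polyC !hornerMXaddC /=.
by apply: (@rpredD _ Sr) (@rpredM _ Sr _ _ IH Su) (Siota c).
Qed.

(** An algebraic nonzero [x] has an inverse that is a polynomial in [x] over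
    [K], read off a relation with nonzero constant coefficient; functionality
    carries this relation over to the image of [x].  So closure under inverses
    comes for free. *)
Lemma partial_endo_inv u : S u -> u.1 != 0 -> exists2 t, S t & t * u = 1.
Proof.
move=> Su u1; have [g] := algF u.1; elim/poly_ind: g => [|g c IH].
  by rewrite eqxx.
have [->|c0] := eqVneq c 0.
  rewrite addr0 rmorphM /= map_polyX rootM rootX (negPf u1) orbF => g0 gu.
  by apply: IH gu; apply: contraNneq g0 => ->; rewrite mul0r.
move=> _ /rootP gu {IH}.
have /partial_endoP := partial_endo_poly (g * 'X + c%:P) Su.
rewrite gu => /Sfun; move: gu.
rewrite rmorphD rmorphM /= map_polyX map_polyC !hornerMXaddC /= => /eqP.
rewrite addr_eq0 => /eqP e1 /eqP; rewrite addr_eq0 => /eqP e2.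
pose t : FF := ((map_poly iota g).[u.1], (map_poly iota g).[u.2]).
exists (- t * (iota c^-1, iota c^-1)).
  by apply/partial_endoP; rewrite rpredM // rpredN partial_endo_poly.
have invE (b d : F) : b * d = - iota c -> - b * iota c^-1 * d = 1.
  by move=> e; rewrite mulrAC mulNr e opprK -rmorphM divff ?rmorph1.
by rewrite [LHS]surjective_pairing; congr pair; apply: invE.
Qed.

Lemma partial_endo_adjoin (z : FF) :
  (forall Q, Q \is a polyOver [in S] -> Q.[z].1 = 0 -> Q.[z].2 = 0) ->
  exists S', [/\ partial_endo S', (S `<=` S')%classic & S' z].
Proof.
move=> hz; exists [set u | exists2 Q, Q \is a polyOver Sr & u = Q.[z]]%classic.
have polyS Q : Q \is a polyOver Sr -> Q \is a polyOver [in S].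
  by apply: polyOverS => u; rewrite partial_endoE.
have Sr' u : S u -> u \in Sr by move/partial_endoP.
split=> [|u Su|]; last 2 first.
- by exists u%:P; rewrite ?hornerC // polyOverC Sr'.
- by exists 'X; rewrite ?hornerX // polyOverX.
split=> [||y [Q QS e]].
- split=> [|u t|u t]; rewrite !inE.
  + by exists 1; rewrite ?rpred1 // hornerC.
  + by move=> [P PS ->] [Q QS ->]; exists (P - Q); rewrite ?rpredB // hornerD hornerN.
  + by move=> [P PS ->] [Q QS ->]; exists (P * Q); rewrite ?rpredM // hornerM.
- by move=> a; exists (iota a, iota a)%:P; rewrite ?hornerC // polyOverC.
- by have := hz Q (polyS _ QS); rewrite -e; apply.
Qed.

(** Any root of the image of the minimal polynomial of [x] over the domain is
    an admissible image of [x]. *)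
Lemma partial_endo_step x : exists x', forall Q, Q \is a polyOver [in S] ->
  Q.[(x, x')].1 = 0 -> Q.[(x, x')].2 = 0.
Proof.
pose fst1 : {rmorphism FF -> F} := fst; pose snd1 : {rmorphism FF -> F} := snd.
have ev1 (Q : {poly FF}) z : Q.[z].1 = (map_poly fst1 Q).[z.1].
  by rewrite (horner_map fst1).
have ev2 (Q : {poly FF}) z : Q.[z].2 = (map_poly snd1 Q).[z.2].
  by rewrite (horner_map snd1).
pose good n := `[< exists Q, [/\ Q \is a polyOver Sr, Q \is monic,
  (map_poly fst1 Q).[x] = 0 & size Q = n] >].
have exgood : exists n, good n.
  have [g g0 /rootP gx] := algF x.
  pose dup (a : K) : FF := (iota a, iota a).
  pose g1 := (lead_coef g)^-1 *: g; pose Q := map_poly dup g1.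
  have lg1 : lead_coef g1 = 1 by rewrite lead_coefZ mulVf ?lead_coef_eq0.
  have dup0 : dup 0 = 0 by rewrite /dup rmorph0.
  have dup1 : dup 1 = 1 by rewrite /dup rmorph1.
  have sQ : size Q = size g1 by rewrite size_map_poly_id0 // lg1 dup1 oner_neq0.
  exists (size Q); apply/asboolP; exists Q; split=> //.
  - by apply/polyOverP=> i; rewrite coef_map_id0 //; apply: Siota.
  - by rewrite monicE lead_coefE sQ coef_map_id0 // -lead_coefE lg1 dup1.
  - have -> : map_poly fst1 Q = map_poly iota g1.
      by apply/polyP=> i; rewrite (coef_map iota) (coef_map fst1) coef_map_id0.
    by rewrite map_polyZ hornerZ gx mulr0.
case: (ex_minnP exgood) => n /asboolP [P [PS Pm Px <-]] minP {exgood}.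
have [x' /rootP Px'] : exists x', root (map_poly snd1 P) x'.
  apply/closed_rootP; rewrite size_map_poly_id0 ?(monicP Pm) ?rmorph1 ?oner_neq0 //.
  apply: contra_eqN Px => /eqP/eq_leq/size1_polyC P1.
  have := monicP Pm; rewrite P1 lead_coefC => ->.
  by rewrite rmorph1 hornerC oner_neq0.
exists x' => Q QS; have {}QS : Q \is a polyOver Sr.
  by apply: polyOverS QS => u; rewrite partial_endoE.
have [Q1 [r [_ rS sr ->]]] := polyOver_rem_monic Pm PS QS.
rewrite ev1 ev2 !rmorphD !rmorphM /= !hornerD !hornerM Px Px' !mulr0 !add0r => rx.
suff -> : r = 0 by rewrite rmorph0 horner0.
apply/eqP; apply: contraLR sr => r0; rewrite -leqNgt.
have lS : S (lead_coef r) by apply/partial_endoP; rewrite lead_coefE (polyOverP rS).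
have l1 : (lead_coef r).1 != 0.
  apply: contraNneq r0 => l1; rewrite -lead_coef_eq0.
  move: (lead_coef r) l1 lS => [l1 l2] /= -> /Sfun -> //.
have [t St tl] := partial_endo_inv lS l1.
have str : size (t *: r) = size r.
  apply/eqP; rewrite eqn_leq size_scale_leq leqNgt /=; apply/negP => str.
  have r_gt0 : (0 < size r)%N by apply: leq_trans str.
  have : (t *: r)`_(size r).-1 = 0 by rewrite nth_default // -ltnS prednK.
  by rewrite coefZ -lead_coefE tl => /eqP; rewrite oner_eq0.
rewrite -str; apply: minP; apply/asboolP; exists (t *: r); split=> //.
- by apply: polyOverZ => //; apply/partial_endoP.
- by rewrite monicE lead_coefE str coefZ -lead_coefE tl.
- by rewrite map_polyZ hornerZ rx mulr0.
Qed.
End OnePartialEndo.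

Lemma partial_endo_bigcup (C : set (set FF)) :
  (C `<=` partial_endo)%classic -> (C !=set0)%classic -> total_on C subset ->
  partial_endo (\bigcup_(X in C) X)%classic.
Proof.
move=> CP [X0 CX0] Ctot.
split=> [|a|y [X CX]]; last by have [_ _] := CP _ CX; apply.
- split=> [|u t|u t]; rewrite !inE.
  + by exists X0 => //; have [[/set_mem h _ _] _ _] := CP _ CX0.
  + move=> uC tC; have [X [CX /mem_set Xu /mem_set Xt]] := chain_bigcup2 Ctot uC tC.
    by exists X => //; have [[_ h _] _ _] := CP _ CX; apply/set_mem/h.
  + move=> uC tC; have [X [CX /mem_set Xu /mem_set Xt]] := chain_bigcup2 Ctot uC tC.
    by exists X => //; have [[_ _ h] _ _] := CP _ CX; apply/set_mem/h.
- by exists X0 => //; have [_ h _] := CP _ CX0.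
Qed.

Lemma partial_endo_extend S : partial_endo S ->
  exists s : {rmorphism F -> F}, forall x y, S (x, y) -> s x = y.
Proof.
move=> hS; have [T [hT ST maxT]] := zorn_above hS partial_endo_bigcup.
have /choice[s Ts] x : exists y, T (x, y).
  have [y /(partial_endo_adjoin hT)[T' [hT' TT' T'xy]]] := partial_endo_step hT x.
  by exists y; rewrite -(maxT _ hT' TT').
have [[T1 TB TM] _ Tfun] := hT.
have Teq x y : T (x, y) -> s x = y.
  move=> Txy; apply/eqP; rewrite -subr_eq0; apply/eqP/Tfun/set_mem.
  have -> : (0, s x - y) = (x, s x) - (x, y) :> FF by rewrite [RHS]surjective_pairing /= subrr.
  by apply: TB; apply/mem_set.
have sB : zmod_morphism s.
  by move=> x y; apply/Teq/set_mem; apply: TB (mem_set (Ts x)) (mem_set (Ts y)).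
have sM : GRing.monoid_morphism s.
  split=> [|x y]; first by apply/Teq/set_mem.
  by apply/Teq/set_mem; apply: TM (mem_set (Ts x)) (mem_set (Ts y)).
pose s1 : {rmorphism F -> F} := HB.pack s (GRing.isZmodMorphism.Build F F s sB)
  (GRing.isMonoidMorphism.Build F F s sM).
by exists s1 => x y Sxy; apply/Teq/ST.
Qed.

(** The relations over [L] make [L]-conjugation a partial endomorphism; Zorn's
    lemma extends it to all of [F]. *)
Lemma subext_conj L x x' : subext iota L ->
  (forall Q, Q \is a polyOver [in L] -> Q.[x] = 0 -> Q.[x'] = 0) ->
  exists s : {rmorphism F -> F}, fixes L s /\ s x = x'.
Proof.
move=> hL hx; have [[L1 LB _] LK] := hL.
pose D := [set u : FF | u.1 = u.2 /\ L u.1]%classic.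
have hD : partial_endo D.
  have LM : {in L &, forall y z, y * z \in L} by move=> y z; apply: (@rpredM _ (subfield_pred hL)).
  split=> [|a|y [] //].
  - split=> [|u t|u t]; rewrite !inE.
    + by split=> //; apply: set_mem.
    + move=> [e1 L1'] [e2 L2]; split=> /=; first by rewrite e1 e2.
      by apply/set_mem/LB; apply/mem_set.
    + move=> [e1 L1'] [e2 L2]; split=> /=; first by rewrite e1 e2.
      by apply/set_mem/LM; apply/mem_set.
  - by split=> //; apply: LK; exists a.
have [|S' [hS' DS' S'x]] := @partial_endo_adjoin D hD (x, x').
  move=> Q QD; have [hDr _ _] := hD.
  have {}QD : Q \is a polyOver (subring_pred hDr) by [].
  move/polyOverP in QD.
  have e : map_poly fst Q = map_poly snd Q :> {poly F}.
    apply/polyP=> i; rewrite !coef_map /=.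
    by have /set_mem[] := QD i.
  have -> : Q.[(x, x')].1 = (map_poly fst Q).[x] by rewrite -(horner_map fst).
  have -> : Q.[(x, x')].2 = (map_poly fst Q).[x'] by rewrite e -(horner_map snd).
  apply: hx; suff : map_poly fst Q \is a polyOver (subfield_pred hL) by [].
  apply/polyOverP=> i; rewrite coef_map /=.
  by have /set_mem[_ ?] := QD i; apply/mem_set.
have [s hs] := partial_endo_extend hS'.
by exists s; split=> [y Ly|]; apply: hs => //; apply: DS'.
Qed.

End PartialEndomorphisms.

(** * Fixed elements and orbits *)

Lemma perm_map_inj (T : eqType) (f : T -> T) (t : seq T) : injective f -> uniq t ->
  {subset map f t <= t} -> perm_eq (map f t) t.
Proof.
move=> inj_f ut sub; have um : uniq (map f t) by rewrite map_inj_uniq.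
by apply: uniq_perm => //; have [] := uniq_min_size um sub; rewrite ?size_map.
Qed.

Lemma subext_range (K F : fieldType) (iota : {rmorphism K -> F}) :
  subext iota (range iota).
Proof.
split=> //; split=> [|x y|x y]; rewrite !inE.
- by exists 1; rewrite ?rmorph1.
- by move=> [a _ <-] [b _ <-]; exists (a - b); rewrite ?rmorphB.
- by move=> [a _ <-] [b _ <-]; exists (a / b); rewrite ?rmorphM ?fmorphV.
Qed.

Section Conjugation.
Variables (K : fieldType) (F : closedFieldType) (iota : {rmorphism K -> F}).
Hypothesis algF : is_algebraic iota.
Hypothesis charK : [pchar K] =i pred0.
Implicit Types (L : set F) (s : {rmorphism F -> F}).

Lemma fixes_sub L L' s : (L `<=` L')%classic -> fixes L' s -> fixes L s.
Proof. by move=> LL' h x Lx; apply/h/LL'. Qed.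

Lemma fixes_iota L s : subext iota L -> fixes L s -> forall a, s (iota a) = iota a.
Proof. by move=> [_ LK] h a; apply/h/LK; exists a. Qed.

Lemma fixes_comp L s t : fixes L s -> fixes L t -> fixes L (s \o t).
Proof. by move=> hs ht x Lx /=; rewrite ht ?hs. Qed.

Lemma minpoly_over L x : subext iota L -> exists P,
  [/\ P \is a polyOver [in L], P \is monic, P.[x] = 0 &
      forall Q, Q \is a polyOver [in L] -> Q.[x] = 0 -> (size Q < size P)%N -> Q = 0].
Proof.
move=> hL; pose S := subfield_pred hL.
pose good n := `[< exists Q, [/\ Q \is a polyOver S, Q \is monic, Q.[x] = 0
  & size Q = n] >].
have monicize Q : Q \is a polyOver S -> Q != 0 -> Q.[x] = 0 -> good (size Q).
  move=> QS Q0 Qx; have l0 : (lead_coef Q)^-1 != 0 by rewrite invr_eq0 lead_coef_eq0.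
  apply/asboolP; exists ((lead_coef Q)^-1 *: Q); split.
  - by apply: (@polyOverZ _ S) => //; rewrite rpredV lead_coefE (polyOverP QS).
  - by rewrite monicE lead_coefZ mulVf // lead_coef_eq0.
  - by rewrite hornerZ Qx mulr0.
  - by rewrite size_scale.
have exgood : exists n, good n.
  have [g g0 /rootP gx] := algF x.
  exists (size (map_poly iota g)); apply: monicize => //; last by rewrite map_poly_eq0.
  apply/polyOverP => i; rewrite coef_map; apply/mem_set; apply: hL.2.
  by exists g`_i.
case: (ex_minnP exgood) => _ /asboolP [P [PS Pm Px <-]] minP {exgood}.
exists P; split=> // Q QS Qx; apply: contraTeq => Q0.
by rewrite -leqNgt minP // monicize.
Qed.

Lemma nat_neq0 n : (n%:R == 0 :> F) = (n == 0%N).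
Proof.
have /pcharf0P h := charK.
by rewrite -(rmorph_nat iota) fmorph_eq0 h.
Qed.

(** The minimal polynomial of [x] over [L] is separable of degree at least 2, so
    it has a root other than [x], to which [x] can be sent. *)
Lemma subext_moved L x : subext iota L -> ~ L x ->
  exists s, fixes L s /\ s x <> x.
Proof.
move=> hL nLx; have [P [PL Pm Px minP]] := minpoly_over x hL.
pose S := subfield_pred hL; have PS : P \is a polyOver S by [].
have P0 : P != 0 by rewrite monic_neq0.
have sP : (2 < size P)%N.
  rewrite ltnNge; apply/negP => sP; apply: nLx.
  have /factor_theorem [Q PQ] : root P x by apply/rootP.
  have Qm : Q \is monic by move: Pm; rewrite PQ monicMr ?monicXsubC.
  have /size1_polyC Q1 : (size Q <= 1)%N.
    by move: sP; rewrite PQ size_Mmonic ?monicXsubC ?monic_neq0 // size_XsubC addn2.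
  have {}PQ : P = 'X - x%:P.
    rewrite PQ; suff -> : Q = 1 by rewrite mul1r.
    by rewrite Q1; congr _%:P; move: (monicP Qm); rewrite {1}Q1 lead_coefC.
  have : P`_0 \in S by rewrite (polyOverP PS).
  by rewrite PQ coefB coefX coefC sub0r rpredN => /set_mem.
have dP : P^`() != 0.
  apply: contraTneq sP => dP; have : P^`()`_(size P).-2 = 0 by rewrite dP coef0.
  rewrite coef_deriv; case: (size P) (lead_coefE P) => [|[|m]] //=.
  by rewrite (monicP Pm) => <- /eqP; rewrite nat_neq0.
have dPx : P^`().[x] != 0.
  apply: contra_neq dP => dPx; apply: minP => //; last exact: lt_size_deriv.
  by have := polyOver_deriv PS.
have /factor_theorem [Q PQ] : root P x by apply/rootP.
have [x' Qx'] : exists x', Q.[x'] = 0.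
  suff /closed_rootP [y /rootP Qy] : size Q != 1 by exists y.
  apply: contraTneq sP => sQ.
  rewrite PQ size_Mmonic ?monicXsubC ?size_XsubC ?sQ //.
  by rewrite -size_poly_eq0 sQ.
have Px' : (Q * ('X - x%:P)).[x'] = 0 by rewrite hornerM Qx' mul0r.
have [|s [hs sx]] := @subext_conj _ _ _ algF L x x' hL.
  move=> R RL Rx; have RS : R \is a polyOver S by [].
  have [R1 [r [_ rS sr e]]] := polyOver_rem_monic Pm PS RS.
  have r0 : r = 0 by apply: minP => //; move: Rx; rewrite e hornerD hornerM Px mulr0 add0r.
  by rewrite e r0 addr0 hornerM PQ Px' mulr0.
exists s; split=> //; rewrite sx => xx'.
move: dPx Qx'; rewrite xx' PQ derivM hornerD !hornerM hornerXsubC subrr mulr0 add0r.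
by move=> + Qx; rewrite Qx mul0r eqxx.
Qed.

Lemma fixed_subext L x : subext iota L -> (forall s, fixes L s -> s x = x) -> L x.
Proof.
by move=> hL h; apply: contrapT => /(subext_moved hL) [s [/h]].
Qed.

Definition conj_pairs L (z : F * F) : set (F * F) :=
  [set u | exists2 s, fixes L s & u = (s z.1, s z.2)]%classic.

Lemma finite_conj L x : subext iota L ->
  finite_set [set y | exists2 s, fixes L s & y = s x]%classic.
Proof.
move=> hL; have [g g0 /rootP gx] := algF x.
have [r er] := closed_field_poly_normal (map_poly iota g).
apply: (@sub_finite_set _ _ [set` r]%classic); last by apply/finite_seqP; exists r.
move=> _ [s hs ->] /=.
have : root (map_poly iota g) (s x).
  have -> : map_poly iota g = map_poly s (map_poly iota g).
    by apply/polyP=> i; rewrite !coef_map /= (fixes_iota hL).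
  by apply/rootP; rewrite horner_map gx rmorph0.
by rewrite er rootZ ?lead_coef_eq0 ?map_poly_eq0 // root_prod_XsubC.
Qed.

Lemma conj_pairs_seq L z : subext iota L ->
  exists t, uniq t /\ forall u, u \in t <-> conj_pairs L z u.
Proof.
move=> hL; have /finite_seqP[t et] : finite_set (conj_pairs L z).
  apply: sub_finite_set (finite_setX (finite_conj z.1 hL) (finite_conj z.2 hL)).
  by move=> _ [s hs ->]; split; exists s.
by exists (undup t); rewrite undup_uniq; split=> // u; rewrite mem_undup et.
Qed.

(** Post-composition with [s] permutes an orbit, because an
    injective self-map of a finite set is bijective. *)
Lemma conj_pairs_perm L z t s : uniq t -> (forall u, u \in t <-> conj_pairs L z u) ->
  fixes L s -> perm_eq [seq (s u.1, s u.2) | u <- t] t.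
Proof.
move=> ut ht hs; apply: perm_map_inj => //.
  by move=> [u1 u2] [v1 v2] /= [/fmorph_inj -> /fmorph_inj ->].
move=> _ /mapP[u /ht [s' hs' ->] ->]; apply/ht.
by exists (s \o s'); first exact: fixes_comp.
Qed.

Lemma conj_seq L x : subext iota L ->
  exists t, uniq t /\ forall z, z \in t <-> exists2 s, fixes L s & z = s x.
Proof.
move=> hL; have /finite_seqP[t et] := finite_conj x hL.
exists (undup t); rewrite undup_uniq; split=> // z; rewrite mem_undup.
by split=> [zt|h]; [have : [set` t]%classic z by []; rewrite -et|
  have : [set` t]%classic z by rewrite -et].
Qed.

(** Every endomorphism over [L] permutes the factors, so it fixes the
    coefficients. *)
Lemma conj_poly_polyOver L x t : subext iota L -> uniq t ->
  (forall z, z \in t <-> exists2 s, fixes L s & z = s x) ->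
  \prod_(z <- t) ('X - z%:P) \is a polyOver [in L].
Proof.
move=> hL ut ht; suff : \prod_(z <- t) ('X - z%:P) \is a polyOver (subfield_pred hL) by [].
apply/polyOverP => i; apply/mem_set/(fixed_subext hL) => s hs.
rewrite -coef_map /= rmorph_prod /=.
under eq_bigr => z _ do rewrite rmorphB /= map_polyX map_polyC /=.
rewrite -(big_map s predT (fun z => 'X - z%:P)); rewrite (perm_big t) //=.
apply: perm_map_inj => //; first exact: fmorph_inj.
move=> _ /mapP[z /ht [s' hs' ->] ->]; apply/ht.
by exists (s \o s'); first exact: fixes_comp.
Qed.

End Conjugation.

(** * Valuation rings and residues *)

Section Valuation.
Variables (F : fieldType) (G : oagType) (w : valuation F G).
Local Notation O := (in_valring w).

Lemma in_valringE x : (x \in O) = ((0 : withoo G) <= w x)%O.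
Proof. by []. Qed.

(** The maximal ideal as a subset of the field, next to [in_valring]; being small
    is meaningful for elements that are not known to be integral. *)
Definition small : pred F := fun x => ((0 : withoo G) < w x)%O.

Lemma small0 : 0 \in small.
Proof. by rewrite unfold_in Defs.val0. Qed.

Lemma smallW x : x \in small -> x \in O.
Proof. by rewrite in_valringE unfold_in => /ltW. Qed.

Fact small_zmod_closed : zmod_closed small.
Proof. by split=> [|x y]; [exact: small0|apply: valB_gt0]. Qed.
HB.instance Definition _ := GRing.isZmodClosed.Build F small small_zmod_closed.

Lemma smallMl x y : x \in O -> y \in small -> x * y \in small.
Proof. by rewrite !unfold_in Defs.valM; apply: oo_addr_gt0. Qed.

Lemma smallMr x y : y \in O -> x \in small -> x * y \in small.
Proof. by rewrite mulrC; apply: smallMl. Qed.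

Lemma smallX x m : (0 < m)%N -> x \in small -> x ^+ m \in small.
Proof. by case: m => // m _ xs; rewrite exprS smallMr // rpredX // smallW. Qed.

Lemma one_notin_small : 1 \notin small.
Proof. by rewrite unfold_in Defs.val1 ltxx. Qed.

Lemma valV_ge0 x : x != 0 -> (x^-1 \in O) = (w x <= 0)%O.
Proof.
move=> x0; rewrite in_valringE; have := Defs.valM w x^-1 x.
have := val_eqoo w x; have := val_eqoo w x^-1.
rewrite mulVf // Defs.val1 invr_eq0 (negPf x0).
case: (w x) (w x^-1) => [a|] [b|] //= _ _ [e].
apply/idP/idP => h; have := oag_leD2l.
  by move/(_ _ a _ _ h); rewrite addr0 addrC -e.
by move/(_ _ b _ _ h); rewrite addr0 -e.
Qed.

Lemma smallN_inv x : x \notin small -> x != 0 /\ x^-1 \in O.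
Proof.
move=> nx; have x0 : x != 0 by apply: contraNneq nx => ->; exact: small0.
by split=> //; rewrite valV_ge0 // leNgt.
Qed.

Lemma inv_small x : x \notin O -> x^-1 \in small.
Proof.
rewrite -{1}[x]invrK => nx; apply: contraNT nx => /smallN_inv [] //.
Qed.

Lemma smallM_notin x y : x * y \in small -> x \notin small -> y \in small.
Proof. by move=> xy /smallN_inv[x0 xO]; rewrite -(mulKf x0 y) smallMl. Qed.

Lemma small_prod (I : eqType) (r : seq I) (f : I -> F) :
  \prod_(i <- r) f i \in small -> exists2 i, i \in r & f i \in small.
Proof.
elim: r => [|i r IH]; first by rewrite big_nil (negPf one_notin_small).
rewrite big_cons => fs; have [fi|fi] := boolP (f i \in small).
  by exists i; rewrite ?mem_head.
by have [j jr fj] := IH (smallM_notin fs fi); exists j; rewrite ?in_cons ?jr ?orbT.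
Qed.

Lemma unit_addsmall x e : w x = 0 -> e \in small -> x + e \notin small.
Proof.
move=> x0 es; apply: contraPN x0 => xes.
have : x \in small by rewrite -(addrK e x) rpredB.
by rewrite unfold_in => /[swap] ->; rewrite ltxx.
Qed.

Lemma val0P x : w x = 0 <-> x \in O /\ x \notin small.
Proof.
split=> [x0|[]]; first by rewrite in_valringE unfold_in x0 ltxx.
by rewrite in_valringE unfold_in -leNgt => h1 h2; apply/le_anti; rewrite h1 h2.
Qed.

Lemma resP x y : x \in O -> y \in O -> res w x = res w y <-> x - y \in small.
Proof.
move=> xO yO; rewrite /res.
set a := insubd _ x; set b := insubd _ y.
have e : (\pi_({ideal_quot maxidealr w})%qT a == \pi_({ideal_quot maxidealr w})%qT b)
    = (x - y \in small).
  rewrite -Quotient.idealrBE unfold_in /=.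
  by rewrite -[valring_val a]/(val a) -[valring_val b]/(val b) !insubdK.
by split=> [/eqP|h]; [rewrite e|apply/eqP; rewrite e].
Qed.

Lemma res_val (u : valring w) : res w (val u) = (\pi_({ideal_quot maxidealr w})%qT u).
Proof. by rewrite /res valKd. Qed.

Lemma res0 : res w 0 = 0.
Proof. by rewrite -(rmorph0 (\val : valring w -> F)) res_val rmorph0. Qed.

Lemma res1 : res w 1 = 1.
Proof. by rewrite -(rmorph1 (\val : valring w -> F)) res_val rmorph1. Qed.

Lemma resD : {in O &, {morph res w : x y / x + y}}.
Proof.
move=> x y xO yO; rewrite -[x](insubdK (0 : valring w)) // -[y](insubdK (0 : valring w)) //.
by rewrite -rmorphD !res_val rmorphD.
Qed.

Lemma resB : {in O &, {morph res w : x y / x - y}}.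
Proof.
move=> x y xO yO; rewrite -[x](insubdK (0 : valring w)) // -[y](insubdK (0 : valring w)) //.
by rewrite -rmorphB !res_val rmorphB.
Qed.

Lemma resM : {in O &, {morph res w : x y / x * y}}.
Proof.
move=> x y xO yO; rewrite -[x](insubdK (0 : valring w)) // -[y](insubdK (0 : valring w)) //.
by rewrite -rmorphM !res_val rmorphM.
Qed.

Lemma resX n : {in O, {morph res w : x / x ^+ n}}.
Proof.
move=> x xO; elim: n => [|n IH]; first by rewrite !expr0 res1.
by rewrite !exprS resM ?rpredX // IH.
Qed.

Lemma res0P x : x \in O -> res w x = 0 <-> x \in small.
Proof. by move=> xO; rewrite -res0 resP ?rpred0 // subr0. Qed.

Lemma res_sum (I : Type) (r : seq I) (f : I -> F) : (forall i, f i \in O) ->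
  res w (\sum_(i <- r) f i) = \sum_(i <- r) res w (f i).
Proof.
move=> fO; elim: r => [|i r IH]; first by rewrite !big_nil res0.
by rewrite !big_cons resD ?rpred_sum // IH.
Qed.

Lemma res_horner (P : {poly F}) x : P \is a polyOver O -> x \in O ->
  res w P.[x] = (map_poly (res w) P).[res w x].
Proof.
move=> /polyOverP PO xO; rewrite horner_coef (horner_coef_wide _ (size_poly _ _)).
rewrite res_sum => [|i]; last by rewrite rpredM ?rpredX.
by apply: eq_bigr => i _; rewrite resM ?rpredX // resX // (coef_map_id0 _ _ res0).
Qed.

(** The reduction of [Q] has more roots than its degree allows. *)
Lemma small_coefs (Q : {poly F}) (r : seq F) :
  Q \is a polyOver O -> {subset r <= O} -> uniq r ->
  {in r &, forall x y, x - y \in small -> x = y} ->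
  {in r, forall x, Q.[x] \in small} -> (size Q <= size r)%N ->
  forall i, Q`_i \in small.
Proof.
move=> QO rO ru rinj rQ sQ i; apply/res0P; first exact: (polyOverP QO).
rewrite -(coef_map_id0 _ _ res0).
suff -> : map_poly (res w) Q = 0 by rewrite coef0.
apply/eqP; apply: contraLR sQ => Q0; rewrite -ltnNge.
have := @max_poly_roots _ _ (map (res w) r) Q0; rewrite size_map => h.
apply: leq_trans (size_poly _ _); apply: h.
  apply/allP => _ /mapP[x xr ->]; apply/rootP.
  by rewrite -res_horner ?rO //; apply/res0P; rewrite ?rQ // rpred_horner ?rO.
rewrite map_inj_in_uniq // => x y xr yr /resP h; apply: rinj => //.
by apply: h; apply: rO.
Qed.

(** A coefficient of least value: dividing by it makes a polynomial primitive. *)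
Lemma max_coef (r : seq F) : has (fun x => x != 0) r ->
  exists x, [/\ x \in r, x != 0 & {in r, forall y, y / x \in O}].
Proof.
elim: r => //= a r IH; have [/IH [x [xr x0 hx]] _|r0] := boolP (has _ r); last first.
  rewrite orbF => a0; exists a; split=> //; rewrite ?mem_head // => y.
  rewrite in_cons => /orP[/eqP ->|yr]; first by rewrite divff // rpred1.
  by move/hasPn: r0 => /(_ _ yr); rewrite negbK => /eqP ->; rewrite mul0r rpred0.
have [axO|axO] := boolP (a / x \in O).
  exists x; split=> //; first by rewrite in_cons xr orbT.
  by move=> y; rewrite in_cons => /orP[/eqP ->|/hx].
have xa : x / a \in O by rewrite -invf_div smallW // inv_small.
have a0 : a != 0 by apply: contraNneq axO => ->; rewrite mul0r rpred0.
exists a; split=> //; first exact: mem_head.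
move=> y; rewrite in_cons => /orP[/eqP ->|/hx yx]; first by rewrite divff // rpred1.
by rewrite -(divfK x0 y) -mulrA rpredM.
Qed.

End Valuation.

Section HenselianConjugation.
Variables (K F : fieldType) (iota : {rmorphism K -> F}) (G : oagType).
Variables (v : valuation K G) (H : oagType) (w : valuation F H).
Hypothesis hens : henselian iota v.
Hypothesis vw : val_extends iota v w.
Variable s : {rmorphism F -> F}.
Hypothesis s_iota : forall a, s (iota a) = iota a.

Lemma ext_in_valring a : (iota a \in in_valring w) = (a \in in_valring v).
Proof. exact: vw. Qed.

Lemma ext_small a : (iota a \in small w) = (a \in small v).
Proof.
have [->|a0] := eqVneq a 0; first by rewrite rmorph0 !small0.
have nsmall (F' : fieldType) (G' : oagType) (u : valuation F' G') x : x != 0 ->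
    (x \in small u) = (x^-1 \notin in_valring u).
  by move=> x0; rewrite valV_ge0 // -ltNge.
by rewrite !nsmall ?fmorph_eq0 // -fmorphV ext_in_valring.
Qed.

Lemma ext_val0 a : v a = 0 -> w (iota a) = 0.
Proof. by move/val0P => h; apply/val0P; rewrite ext_in_valring ext_small. Qed.

Let w_s : valuation F H.
Proof.
exists (fun x => w (s x)) => [x|x y|x y].
- by rewrite val_eqoo fmorph_eq0.
- by rewrite rmorphM Defs.valM.
- by rewrite rmorphD Defs.valD.
Defined.

(** Composing [w] with [s] yields a valuation that extends [v] as well, and
    such an extension is unique up to equivalence. *)
Lemma conj_in_valring x : (s x \in in_valring w) = (x \in in_valring w).
Proof.
by symmetry; apply: (hens.2 _ _ w w_s vw) => a; rewrite /= s_iota; apply: vw.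
Qed.

Lemma conj_small x : (s x \in small w) = (x \in small w).
Proof.
have [->|x0] := eqVneq x 0; first by rewrite rmorph0.
have nsmall y : y != 0 -> (y \in small w) = (y^-1 \notin in_valring w).
  by move=> y0; rewrite valV_ge0 // -ltNge.
by rewrite !nsmall ?fmorph_eq0 // -fmorphV conj_in_valring.
Qed.

End HenselianConjugation.

(** * Additive polynomials in mixed characteristic *)

Lemma prime_dvd_bin_pow p i j : prime p -> (0 < j < p ^ i)%N -> (p %| 'C(p ^ i, j))%N.
Proof.
move=> p_pr /andP[]; case: j => // j _ ji.
have [//|] := boolP (p %| 'C(p ^ i, j.+1))%N; rewrite -prime_coprime // => cop.
have : (p ^ i %| j.+1 * 'C(p ^ i, j.+1))%N by rewrite -mul_bin_diag dvdn_mulr.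
rewrite Gauss_dvdl ?coprimeXl // => /(dvdn_leq (ltn0Sn j)).
by rewrite leqNgt ji.
Qed.

Section AdditivePolynomial.
Variables (F : closedFieldType) (G : oagType) (w : valuation F G).
Variables (p n : nat) (a : 'I_n.+1 -> F).
Hypothesis p_pr : prime p.
Hypothesis p_small : p%:R \in small w.
Hypothesis aO : forall i, a i \in in_valring w.
Hypothesis a0 : w (a ord0) = 0.
Hypothesis an : w (a ord_max) = 0.
Local Notation O := (in_valring w).
Local Notation m := (small w).
Local Notation N := (p ^ n)%N.

Definition addpoly (t : F) : F := \sum_(i < n.+1) a i * t ^+ (p ^ i).

(** The condition [w t > - w p / p ^ n], without division in the value group. *)
Definition moderate : pred F := fun t => t ^+ N * p%:R \in m.

Let p_gt0 i : (0 < p ^ i)%N.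
Proof. by rewrite expn_gt0 prime_gt0. Qed.

Let leN (i : 'I_n.+1) : (p ^ i <= N)%N.
Proof. by rewrite leq_pexp2l ?prime_gt0 // -ltnS. Qed.

(** For exponents below [p ^ n] the bound only improves when [t] is not
    integral, and [p] alone is small when it is. *)
Lemma moderate_exp t k : moderate t -> (k <= N)%N -> t ^+ k * p%:R \in m.
Proof.
move=> mt kN; have [tO|tO] := boolP (t \in O); first by rewrite smallMl ?rpredX.
have t0 : t != 0 by apply: contraNneq tO => ->; rewrite rpred0.
rewrite -(mulKf (expf_neq0 (N - k) t0) (t ^+ k * _)) [t ^+ (N - k) * _]mulrA -exprD subnK //.
rewrite smallMl // -exprVn rpredX // smallW //; exact: inv_small.
Qed.

Lemma moderateD t y : moderate t -> y \in O -> moderate (t + y).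
Proof.
move=> mt yO; have [tO|tO] := boolP (t \in O).
  by rewrite /moderate smallMl // rpredX // rpredD.
have t0 : t != 0 by apply: contraNneq tO => ->; rewrite rpred0.
have -> : t + y = (1 + y / t) * t by rewrite mulrDl mul1r divfK.
rewrite /moderate exprMn -mulrA smallMl // rpredX // rpredD ?rpred1 //.
by rewrite rpredM // smallW // inv_small.
Qed.

(** The inner binomial coefficients are divisible by [p], and moderation is
    exactly what makes [p] absorb the powers of [t]. *)
Lemma exp_moderateD t y (i : 'I_n.+1) : moderate t ->
  exists c : nat -> F, (forall j, c j \in m) /\
    (t + y) ^+ (p ^ i) = t ^+ (p ^ i) + y ^+ (p ^ i) +
                         \sum_(j < (p ^ i).-1) c j * y ^+ j.+1.
Proof.
move=> mt; pose c j := if (j.+1 < p ^ i)%N then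
  t ^+ (p ^ i - j.+1) *+ 'C(p ^ i, j.+1) else 0.
exists c; split=> [j|].
  rewrite /c; case: ifP => [ji|_]; last exact: small0.
  have /dvdnP[q ->] : (p %| 'C(p ^ i, j.+1))%N by apply: prime_dvd_bin_pow.
  rewrite -mulr_natr natrM [q%:R * _]mulrC mulrA smallMr ?rpred_nat //.
  by rewrite moderate_exp // (leq_trans (leq_subr _ _)).
rewrite exprDn /c {c}; case: (p ^ i)%N (p_gt0 i) => // k _ /=.
rewrite big_ord_recl big_ord_recr /= subn0 subnn expr0 mul1r mulr1 bin0 binn.
rewrite /bump /= addrAC addrA; congr (_ + _ + _).
apply: eq_bigr => j _; rewrite ltnS ltn_ord add1n.
by rewrite mulrnAl.
Qed.

(** Additivity up to an error that is small relative to [y]. *)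
Lemma addpolyD t y : moderate t -> y \in O ->
  exists2 e, e \in m & addpoly (t + y) = addpoly t + addpoly y + y * e.
Proof.
move=> mt yO; have /choice[e he] (i : 'I_n.+1) : exists e, e \in m /\
    (t + y) ^+ (p ^ i) = t ^+ (p ^ i) + y ^+ (p ^ i) + y * e.
  have [c [cm ->]] := exp_moderateD y i mt.
  exists (\sum_(j < (p ^ i).-1) c j * y ^+ j); split.
    by apply: rpred_sum => j _; rewrite smallMr ?rpredX.
  by congr (_ + _); rewrite mulr_sumr; apply: eq_bigr => j _; rewrite mulrCA exprS.
exists (\sum_i a i * e i).
  by apply: rpred_sum => i _; rewrite smallMl //; have [] := he i.
rewrite mulr_sumr -!big_split; apply: eq_bigr => i _ /=.
by have [_ ->] := he i; rewrite !mulrDr [y * (_ * _)]mulrCA.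
Qed.

(** For [y] of negative value the leading monomial of [y] dominates:
    multiplied by [y ^- (p ^ n)], the difference becomes the unit leading
    coefficient plus an element of [m]. *)
Lemma addpolyB_notin t y : moderate t -> y \notin O ->
  addpoly (t + y) - addpoly t \notin O.
Proof.
move=> mt yO; have y0 : y != 0 by apply: contraNneq yO => ->; rewrite rpred0.
have ys := inv_small yO.
have yX k : (k <= N)%N -> y ^+ k * y^-1 ^+ N = y^-1 ^+ (N - k).
  by move=> kN; rewrite -{1}(subnK kN) addnC exprD mulrA -exprMn divff // expr1n mul1r.
have /choice[e he] (i : 'I_n.+1) : exists e, e \in m /\
    ((t + y) ^+ (p ^ i) - t ^+ (p ^ i)) * y^-1 ^+ N = (i == ord_max)%:R + e.
  have [c [cm ->]] := exp_moderateD y i mt.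
  exists ((i != ord_max)%:R * y^-1 ^+ (N - p ^ i) +
          \sum_(j < (p ^ i).-1) c j * y^-1 ^+ (N - j.+1)); split.
    rewrite rpredD //.
      have [->|ni] := eqVneq i ord_max; first by rewrite mul0r small0.
      rewrite mul1r smallX // subn_gt0 ltn_exp2l ?prime_gt1 //.
      by rewrite ltn_neqAle -ltnS ltn_ord andbT.
    by apply: rpred_sum => j _; rewrite smallMr // rpredX // smallW.
  rewrite addrAC [t ^+ _ + _]addrC addrK mulrDl addrA; congr (_ + _).
    rewrite yX //; case: (eqVneq i ord_max) => [->|_] /=.
      by rewrite subnn expr0 mul0r addr0.
    by rewrite mul1r add0r.
  rewrite mulr_suml; apply: eq_bigr => j _; rewrite -mulrA yX //.
  by rewrite (leq_trans (ltn_ord j)) // (leq_trans (leq_pred _)) // leN.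
pose r := \sum_i a i * e i.
have rm : r \in m.
  by apply: rpred_sum => i _; rewrite smallMl //; have [] := he i.
have e1 : (addpoly (t + y) - addpoly t) * y^-1 ^+ N = a ord_max + r.
  rewrite /addpoly -sumrB mulr_suml /r.
  have -> : a ord_max = \sum_i a i * (i == ord_max)%:R.
    rewrite (bigD1 ord_max) //= eqxx mulr1 big1 ?addr0 // => i /negPf ->.
    by rewrite mulr0.
  rewrite -big_split; apply: eq_bigr => i _ /=; have [_ hi] := he i.
  by rewrite -mulrBr -mulrA hi mulrDr.
apply/negP => zO; move: (unit_addsmall an rm); rewrite -e1.
by rewrite smallMl // smallX.
Qed.

(** Near 0 the linear term dominates, as its coefficient is a unit. *)
Lemma addpoly_inj_small t d : moderate t -> d \in m ->
  addpoly (t + d) = addpoly t -> d = 0.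
Proof.
move=> mt ds; have [e em ->] := addpolyD mt (smallW ds).
rewrite -addrA -[X in _ = X]addr0 => /addrI /eqP.
pose f := \sum_(i < n) a (lift ord0 i) * d ^+ (p ^ i.+1).-1.
have -> : addpoly d + d * e = d * (a ord0 + (f + e)).
  rewrite !mulrDr addrA /addpoly big_ord_recl expn0 expr1 mulrC; congr (_ + _ + _).
  rewrite mulr_sumr; apply: eq_bigr => i _; rewrite mulrCA -exprS prednK //.
rewrite mulf_eq0 => /orP[/eqP //|/eqP h].
have fm : f \in m.
  apply: rpred_sum => i _; rewrite smallMl // smallX // -ltnS prednK //.
  by rewrite -(exp1n i.+1) ltn_exp2r // prime_gt1.
by have := unit_addsmall a0 (rpredD fm em); rewrite h small0.
Qed.

Definition Addpoly : {poly F} := \sum_(i < n.+1) a i *: 'X^(p ^ i).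

Lemma Addpoly_horner t : Addpoly.[t] = addpoly t.
Proof.
by rewrite horner_sum; apply: eq_bigr => i _; rewrite hornerZ hornerXn.
Qed.

Lemma size_Addpoly b :
  size (Addpoly - b%:P) = N.+1 /\ lead_coef (Addpoly - b%:P) = a ord_max.
Proof.
have an0 : a ord_max != 0 by apply: contra_eq_neq an => ->; rewrite Defs.val0.
have low : (size (\sum_(i < n) (a (widen_ord (leqnSn n) i) *: 'X^(p ^ i) : {poly F}) - b%:P)%R
    < size (a ord_max *: 'X^N : {poly F}))%N.
  rewrite size_scale // size_polyXn ltnS (leq_trans (size_polyD _ _)) // geq_max.
  rewrite size_polyN (leq_trans (size_polyC_leq1 b)) // andbT.
  apply: (leq_trans (size_sum _ _ _)); apply/bigmax_leqP => i _.
  apply: leq_trans (size_scale_leq _ _) _; rewrite size_polyXn.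
  by rewrite ltn_exp2l ?prime_gt1.
rewrite /Addpoly big_ord_recr /= addrAC addrC.
by rewrite size_polyDl // lead_coefDl // size_scale // size_polyXn lead_coefZ lead_coefXn mulr1.
Qed.

Lemma addpoly_surj b : exists s, addpoly s = b.
Proof.
have [sz _] := size_Addpoly b.
have /closed_rootP[s /rootP] : size (Addpoly - b%:P) != 1%N.
  by rewrite sz eqSS -lt0n.
rewrite hornerD hornerN hornerC Addpoly_horner => /eqP; rewrite subr_eq0 => /eqP.
by exists s.
Qed.

(** [addpoly t - b] is a unit times the product of the distances from [t] to
    the roots, so one distance must be small. *)
Lemma addpoly_root_near t b : addpoly t - b \in m ->
  exists2 s, addpoly s = b & t - s \in m.
Proof.
have [_ lc] := size_Addpoly b.
have [r er] := closed_field_poly_normal (Addpoly - b%:P).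
have ev x : addpoly x - b = a ord_max * \prod_(z <- r) (x - z).
  rewrite -Addpoly_horner -[b](hornerC b x) -hornerN -hornerD er hornerZ lc horner_prod.
  by congr (_ * _); apply: eq_bigr => z _; rewrite hornerXsubC.
have /val0P[_ nan] := an.
rewrite ev => /smallM_notin -/(_ nan) /small_prod [z zr tz].
exists z => //; apply/eqP; rewrite -subr_eq0 ev mulf_eq0; apply/orP; right.
by rewrite (big_rem z) //= subrr mul0r.
Qed.

End AdditivePolynomial.

(** * Lifting the action on residues *)

(** A pair of elements is encoded as a linear polynomial, so that an orbit of pairs has
    an orbit polynomial over an integral domain, also when the residue field
    is too small for a linear combination with constant coefficients to
    separate the orbit. *)
Definition pencil (R : nzRingType) (u : R * R) : {poly R} := u.1%:P + u.2 *: 'X.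

Lemma pencil_inj (R : nzRingType) : injective (@pencil R).
Proof.
move=> [a b] [c d] e; have cE i := congr1 (fun q : {poly R} => q`_i) e.
have := cE 0%N; have := cE 1%N.
by rewrite !coefD !coefC !coefZ !coefX /= !mulr0 !mulr1 !addr0 !add0r => -> ->.
Qed.

Lemma map_pencil (R S : nzRingType) (f : {rmorphism R -> S}) u :
  map_poly f (pencil u) = pencil (f u.1, f u.2).
Proof. by rewrite rmorphD /= map_polyC map_polyZ map_polyX. Qed.

Lemma map_prod_pencil (R S : comNzRingType) (f : {rmorphism R -> S}) (t : seq (R * R)) :
  map_poly (map_poly f) (\prod_(u <- t) ('X - (pencil u)%:P)) =
  \prod_(u <- [seq (f u.1, f u.2) | u <- t]) ('X - (pencil u)%:P).
Proof.
rewrite rmorph_prod big_map; apply: eq_bigr => u _.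
by rewrite rmorphB /= map_polyX map_polyC /= map_pencil.
Qed.

Section ResidueLifting.
Variables (K : fieldType) (F : closedFieldType) (iota : {rmorphism K -> F}).
Variables (G : oagType) (v : valuation K G) (H : oagType) (w : valuation F H).
Hypothesis algF : is_algebraic iota.
Hypothesis charK : [pchar K] =i pred0.
Hypothesis hens : henselian iota v.
Hypothesis vw : val_extends iota v w.
Local Notation O := (in_valring w).
Local Notation m := (small w).
Implicit Types (L : set F) (s : {rmorphism F -> F}).

Lemma fixes_in_valring L s : subext iota L -> fixes L s ->
  forall x, (s x \in O) = (x \in O).
Proof. by move=> hL hs; apply: (conj_in_valring hens vw); apply: fixes_iota hL hs. Qed.

Lemma fixes_small L s : subext iota L -> fixes L s ->
  forall x, (s x \in m) = (x \in m).
Proof. by move=> hL hs; apply: (conj_small hens vw); apply: fixes_iota hL hs. Qed.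

(** Being a morphism, reduction after conjugation can be applied to the
    coefficients of an orbit polynomial and then to its factors. *)
Lemma res_conj_rmorphism s : fixes (range iota) s ->
  exists f : {rmorphism valring w -> residue w}, forall u, f u = res w (s (val u)).
Proof.
move=> hs; have sO (u : valring w) : s (val u) \in O.
  by rewrite (fixes_in_valring (subext_range iota) hs) (valP u).
pose f (u : valring w) := res w (s (val u)).
have fB : zmod_morphism f by move=> u z; rewrite /f !rmorphB resB.
have fM : GRing.monoid_morphism f.
  by split=> [|u z]; rewrite /f ?rmorph1 ?res1 // !rmorphM resM.
pose f1 : {rmorphism valring w -> residue w} := HB.pack f
  (GRing.isZmodMorphism.Build _ _ f fB) (GRing.isMonoidMorphism.Build _ _ f fM).
by exists f1.
Qed.

(** The orbit polynomial of the pair [(x, y)] over [L] has its coefficients in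
    [L], so [s] fixes their residues.  Hence the residue of [(x, y)], a root of
    the reduction, is also a root of its image under [s]. *)
Lemma lift_residues L s x y : subext iota L -> fixes (range iota) s ->
  {in O, forall z, L z -> s z - z \in m} -> x \in O -> y \in O ->
  exists2 t, fixes L t & s (t x) - x \in m /\ s (t y) - y \in m.
Proof.
move=> hL hs sL xO yO.
have [r [ur hr]] := conj_pairs_seq algF (x, y) hL.
have rO u : u \in r -> u.1 \in O /\ u.2 \in O.
  by move=> /hr [t ht ->] /=; rewrite !(fixes_in_valring hL ht).
pose r' : seq (valring w * valring w) := [seq (insubd 0 u.1, insubd 0 u.2) | u <- r].
have r'E : [seq (val u.1, val u.2) | u <- r'] = r.
  rewrite -map_comp -[RHS]map_id; apply/eq_in_map => -[u1 u2] /rO [/= h1 h2].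
  by rewrite /= !insubdK.
pose P : {poly {poly valring w}} := \prod_(u <- r') ('X - (pencil u)%:P).
have PL i j : L (val P`_i`_j).
  have -> : val P`_i`_j = (map_poly (map_poly (\val : valring w -> F)) P)`_i`_j.
    by rewrite !coef_map.
  rewrite map_prod_pencil r'E; apply: (fixed_subext algF charK hL) => t ht.
  rewrite -!coef_map /= map_prod_pencil.
  by rewrite (perm_big _ (conj_pairs_perm ur hr ht)).
have [f fE] := res_conj_rmorphism hs.
have [g gE] : exists f : {rmorphism valring w -> residue w}, forall u, f u = res w (val u).
  by have [|g gE] := @res_conj_rmorphism idfun; [move=> ?|exists g].
have fgP : map_poly (map_poly f) P = map_poly (map_poly g) P.
  apply/polyP=> i; apply/polyP=> j; rewrite !coef_map /= fE gE.
  have PO := valP (P`_i`_j).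
  by apply/resP; rewrite ?(fixes_in_valring (subext_range iota) hs) ?sL.
pose u0 := (res w x, res w y).
have : (map_poly (map_poly f) P).[pencil u0] = 0.
  rewrite fgP map_prod_pencil horner_prod.
  have xyr : (insubd 0 x, insubd 0 y) \in r'.
    by apply/mapP; exists (x, y) => //; apply/hr; exists idfun.
  have : u0 \in [seq (g u.1, g u.2) | u <- r'].
    by apply/mapP; exists (insubd 0 x, insubd 0 y); rewrite ?gE /= ?insubdK.
  by move=> u0r; rewrite (big_rem u0) //= hornerXsubC subrr mul0r.
rewrite map_prod_pencil horner_prod => /eqP.
rewrite prodf_seq_eq0 => /hasP[_ /mapP[_ /mapP[u /hr [t ht ->] ->] ->]] /=.
rewrite hornerXsubC subr_eq0 => /eqP e.
exists t => //; have tO z : z \in O -> t z \in O by rewrite (fixes_in_valring hL ht).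
have stO z : z \in O -> s (t z) \in O.
  by rewrite (fixes_in_valring (subext_range iota) hs); apply: tO.
move/pencil_inj: e => [e1 e2]; rewrite !fE /= !insubdK ?tO // in e1 e2.
by split; apply/resP; rewrite ?stO.
Qed.

End ResidueLifting.

(** * Purely inseparable descent *)

Section FrobeniusDescent.
Variables (R : comNzRingType) (p : nat).
Hypothesis pR : p \in [pchar R].

Lemma pchar_pow_nat e : [pchar R].-nat (p ^ e)%N.
Proof. by rewrite pnatX pnatE ?pR ?(pcharf_prime pR). Qed.

Lemma exprB_pchar_pow (x y : R) e :
  (x - y) ^+ (p ^ e) = x ^+ (p ^ e) - y ^+ (p ^ e).
Proof. by rewrite exprDn_pchar ?exprNn_pchar ?pchar_pow_nat. Qed.

Lemma expr_sum_pchar_pow (I : Type) (r : seq I) (f : I -> R) e :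
  (\sum_(i <- r) f i) ^+ (p ^ e) = \sum_(i <- r) f i ^+ (p ^ e).
Proof.
apply: (big_morph (fun x => x ^+ (p ^ e))) => [x y|].
  by rewrite exprDn_pchar ?pchar_pow_nat.
by rewrite expr0n expn_eq0 eqn0Ngt prime_gt0 ?(pcharf_prime pR).
Qed.

(** An additive polynomial with a unit [1 / g] as linear coefficient expresses
    [r] through its [p]-th power; raising to the power [p ^ e] expresses
    [r ^+ (p ^ e)] through [r ^+ (p ^ e.+1)]. *)
Lemma additive_root_descent (S : subringClosed R) n (b : 'I_n.+1 -> R) (g r : R) e :
  (forall i, b i \in S) -> g \in S -> g * b ord0 = 1 ->
  \sum_i b i * r ^+ (p ^ i) \in S -> r ^+ (p ^ e) \in S -> r \in S.
Proof.
move=> bS gS gb sumS; elim: e => [|e IH]; first by rewrite expn0 expr1.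
move=> reS; apply: IH; set q := (p ^ e)%N in reS *.
have -> : r ^+ q = g ^+ q * ((\sum_i b i * r ^+ (p ^ i)) ^+ q -
    \sum_(i < n) b (lift ord0 i) ^+ q * (r ^+ (p ^ e.+1)) ^+ (p ^ i)).
  rewrite expr_sum_pchar_pow big_ord_recl /= expn0 expr1 -/q exprMn.
  rewrite [X in _ + X - _](_ : _ = \sum_(i < n) b (lift ord0 i) ^+ q *
    (r ^+ (p ^ e.+1)) ^+ (p ^ i)).
    by rewrite addrK mulrA -exprMn gb expr1n mul1r.
  apply: eq_bigr => i _; rewrite exprMn -!exprM; congr (_ * r ^+ _).
  by rewrite /q -!expnD /bump /= add1n addSnnS addnC.
rewrite rpredM ?rpredX // rpredB ?rpredX // rpred_sum // => i _.
by apply: rpredM; apply: rpredX => //; apply: bS.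
Qed.

End FrobeniusDescent.

(** * Subextensions with prescribed values and residues *)

Section Subextensions.
Variables (K F : fieldType) (iota : {rmorphism K -> F}).
Implicit Types (L : set F).

Lemma subext_bigcap (C : set (set F)) : (C `<=` subext iota)%classic ->
  subext iota (\bigcap_(L in C) L)%classic.
Proof.
move=> CP; split; last by move=> x Kx L CL; have [_] := CP _ CL; apply.
split=> [|x y|x y]; rewrite !inE.
- by move=> L CL; have [[/set_mem ? _ _] _] := CP _ CL.
- move=> hx hy L CL; have [[_ h _] _] := CP _ CL.
  by apply/set_mem/h; apply/mem_set; [apply: hx|apply: hy].
- move=> hx hy L CL; have [[_ _ h] _] := CP _ CL.
  by apply/set_mem/h; apply/mem_set; [apply: hx|apply: hy].
Qed.

Lemma subext_adjoin t : subext iota (adjoin iota t).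
Proof. by apply: subext_bigcap => L []. Qed.

Lemma mem_adjoin t : adjoin iota t t.
Proof. by move=> L [_ tL]; apply: tL. Qed.

Lemma adjoin_sub t L : subext iota L -> L t -> (adjoin iota t `<=` L)%classic.
Proof. by move=> hL Lt; apply: smallest_sub => // _ ->. Qed.

Lemma subext_bigcup (C : set (set F)) : (C `<=` subext iota)%classic ->
  (C !=set0)%classic -> total_on C subset -> subext iota (\bigcup_(L in C) L)%classic.
Proof.
move=> CP [X0 CX0] Ctot.
split; last by move=> x Kx; exists X0 => //; have [_] := CP _ CX0; apply.
split=> [|u t|u t]; rewrite !inE.
- by exists X0 => //; have [[/set_mem h _ _] _] := CP _ CX0.
- move=> uC tC; have [X [CX /mem_set Xu /mem_set Xt]] := chain_bigcup2 Ctot uC tC.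
  by exists X => //; have [[_ h _] _] := CP _ CX; apply/set_mem/h.
- move=> uC tC; have [X [CX /mem_set Xu /mem_set Xt]] := chain_bigcup2 Ctot uC tC.
  by exists X => //; have [[_ _ h] _] := CP _ CX; apply/set_mem/h.
Qed.

Lemma subext_agree (s t : {rmorphism F -> F}) : fixes (range iota) s ->
  fixes (range iota) t -> subext iota [set x | s x = t x]%classic.
Proof.
move=> hs ht; split; last by move=> x Kx /=; rewrite hs ?ht.
split=> [|x y|x y]; rewrite !inE /=; first by rewrite !rmorph1.
  by move=> e1 e2; rewrite !rmorphB e1 e2.
by move=> e1 e2; rewrite !fmorph_div e1 e2.
Qed.

Variables (H : oagType) (w : valuation F H).

Lemma residue_field_subring L : subext iota L ->
  subring_closed [in @residue_field _ _ w L].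
Proof.
move=> hL; pose S := subfield_pred hL.
have SP x : x \in S <-> L x by split=> [/set_mem|/mem_set].
split=> [|_ _ /set_mem[x [Lx xO] <-] /set_mem[y [Ly yO] <-]|
          _ _ /set_mem[x [Lx xO] <-] /set_mem[y [Ly yO] <-]]; apply/mem_set.
- by exists 1; [split; [apply/SP; apply: rpred1|rewrite Defs.val1]|rewrite res1].
- exists (x - y); last by rewrite resB.
  by split; [apply/SP; apply: rpredB; apply/SP|apply: valB_ge0].
- exists (x * y); last by rewrite resM.
  by split; [apply/SP; apply: rpredM; apply/SP|apply: valM_ge0].
Qed.

(** Purely wild and immediate extensions are both of this form; this is what
    makes a common treatment possible. *)
Definition bounded (V : set H) (R : set (residue w)) L :=
  [/\ subext iota L, (value_group w L `<=` V)%classic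
    & (@residue_field _ _ w L `<=` R)%classic].

Lemma bounded_maximal V R L0 : bounded V R L0 ->
  exists L, maximal (bounded V R) L /\ (L0 `<=` L)%classic.
Proof.
move=> bL0; have [|L [bL L0L maxL]] := zorn_above bL0; last by exists L.
move=> C CP C0 Ctot; split.
- by apply: subext_bigcup => // L /CP[].
- by move=> g [x [L CL Lx] wx]; have [_ h _] := CP _ CL; apply: h; exists x.
- by move=> r [x [[L CL Lx] xO] wx]; have [_ _ h] := CP _ CL; apply: h; exists x.
Qed.

Lemma immediate_bounded : immediate iota w =
  bounded (value_group w (range iota)) (@residue_field _ _ w (range iota)).
Proof.
apply/funext => L; apply/propext; split=> [[hL e1 e2]|[hL h1 h2]].
  by split; rewrite ?e1 ?e2.
have KL : (range iota `<=` L)%classic by case: hL.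
split=> //; apply/seteqP; split=> //.
  by move=> g [x Kx wx]; exists x => //; apply: KL.
by move=> r [x [Kx xO] wx]; exists x => //; split=> //; apply: KL.
Qed.

Lemma purely_wild_bounded p : purely_wild iota w p =
  bounded [set g | exists e, value_group w (range iota) (g *+ (p ^ e)%N)]%classic
    [set r | exists e, @residue_field _ _ w (range iota) (r ^+ (p ^ e)%N)]%classic.
Proof. by []. Qed.

End Subextensions.

(** * The twin extension *)

(** This is [partial_endo_inv] for the identity of [S]. *)
Lemma subring_inv (K : fieldType) (F : closedFieldType) (iota : {rmorphism K -> F})
    (S : subringClosed F) : is_algebraic iota -> (forall a, iota a \in S) ->
  {in S, forall x, x^-1 \in S}.
Proof.
move=> algF SK x xS; have [->|x0] := eqVneq x 0; first by rewrite invr0 rpred0.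
pose D : set (F * F) := [set u | u.1 = u.2 /\ u.1 \in S]%classic.
have hD : partial_endo iota D.
  split=> [|k|z []//]; last by split=> /=.
  split=> [|u t /set_mem[e1 S1] /set_mem[e2 S2]|u t /set_mem[e1 S1] /set_mem[e2 S2]];
    apply/mem_set; split; rewrite /= ?e1 ?e2 ?rpred1 //.
  - by rewrite -e1 -e2 rpredB.
  - by rewrite -e1 -e2 rpredM.
have [|t [_ tS] /(congr1 fst) /= tx] := @partial_endo_inv _ _ _ algF D hD (x, x) _ x0.
  by [].
by rewrite -[x^-1]mul1r -tx mulfK.
Qed.

Section Twin.
Variables (K : fieldType) (F : closedFieldType) (iota : {rmorphism K -> F}).
Variables (G : oagType) (v : valuation K G) (H : oagType) (w : valuation F H).
Hypothesis algF : is_algebraic iota.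
Hypothesis charK : [pchar K] =i pred0.
Hypothesis hens : henselian iota v.
Hypothesis vw : val_extends iota v w.
Variables (p n : nat) (a : 'I_n.+1 -> K).
Hypothesis pv : p \in [pchar (residue v)].
Hypothesis aO : forall i, a i \in in_valring v.
Hypothesis a0 : v (a ord0) = 0.
Hypothesis an : v (a ord_max) = 0.
Local Notation O := (in_valring w).
Local Notation m := (small w).
Implicit Types (L : set F) (s : {rmorphism F -> F}).

Let b i := iota (a i).
Local Notation A := (addpoly p b).

Lemma res_nat (F' : fieldType) (G' : oagType) (u : valuation F' G') k :
  res u k%:R = k%:R.
Proof.
elim: k => [|k IH]; first exact: res0.
by rewrite -natr1 resD ?rpred1 ?rpred_nat // IH res1 natr1.
Qed.

Let p_pr : prime p.
Proof. exact: pcharf_prime pv. Qed.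

Let p_small : p%:R \in m.
Proof.
rewrite -(rmorph_nat iota) (ext_small vw); apply/res0P; first exact: rpred_nat.
by rewrite res_nat (pcharf0 pv).
Qed.

Let pw : p \in [pchar (residue w)].
Proof.
rewrite inE p_pr /= -res_nat; apply/eqP/res0P => //; exact: smallW.
Qed.

Let bO i : b i \in O.
Proof. by rewrite (ext_in_valring vw). Qed.

Let b0 : w (b ord0) = 0.
Proof. exact: ext_val0 vw _ a0. Qed.

Let bn : w (b ord_max) = 0.
Proof. exact: ext_val0 vw _ an. Qed.

Lemma conj_addpoly s x : fixes (range iota) s -> s (A x) = A (s x).
Proof.
move=> hs; rewrite rmorph_sum; apply: eq_bigr => i _.
by rewrite rmorphM rmorphXn /= hs //; exists (a i).
Qed.

(** Residues that are purely inseparable over the residue field of [K] have no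
    other conjugates. *)
Lemma purely_wild_fixed_mod L s : purely_wild iota w p L -> fixes (range iota) s ->
  {in O, forall x, L x -> s x - x \in m}.
Proof.
move=> [hL _ hR] hs x xO Lx.
have hK := subext_range iota.
have [|e [z [[k _ <-] kO] ek]] := hR (res w x); first by exists x.
have sxO : s x \in O by rewrite (fixes_in_valring hens vw hK hs).
apply/resP => //; apply/eqP; rewrite -subr_eq0.
have : (res w (s x) - res w x) ^+ (p ^ e) == 0.
  rewrite (exprB_pchar_pow pw) -ek subr_eq0 -resX //; apply/eqP/resP => //.
    by rewrite rpredX.
  have <- : s (iota k) = iota k by apply: hs; exists k.
  rewrite -rmorphXn -rmorphB (fixes_small hens vw hK hs).
  by apply/resP; rewrite ?rpredX // resX.
by rewrite expf_eq0 => /andP[].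
Qed.

Variables (c d : K) (th th' : F).
Local Notation M := (adjoin iota th).
Local Notation M' := (adjoin iota th').
Hypothesis mth : moderate w p n th.
Hypothesis Ath : A th = iota c.
Hypothesis conj_th : forall z, A z = iota c ->
  exists2 s, fixes (range iota) s & s th = z.
Hypothesis wildM : purely_wild iota w p M.
Hypothesis dO : d \in in_valring v.
Hypothesis Ath' : A th' = iota (c + d).

Let y := th' - th.
Let hK := subext_range iota.
Let hM := subext_adjoin iota th.

Let thy : th + y = th'.
Proof. by rewrite addrC subrK. Qed.

Let yO : y \in O.
Proof.
apply: contraT => /(addpolyB_notin p_pr p_small bO bn mth).
by rewrite thy Ath' Ath rmorphD addrAC subrr add0r (ext_in_valring vw) dO.
Qed.

Let mth' : moderate w p n th'.
Proof. by rewrite -thy; apply: moderateD. Qed.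

Let Ay : A y - iota d \in m.
Proof.
have [e em] := addpolyD p_pr p_small bO mth yO.
rewrite thy Ath' Ath rmorphD -addrA => /addrI ->.
by rewrite opprD addrA subrr sub0r rpredN smallMl.
Qed.

Let moderate_conj s t : fixes (range iota) s -> moderate w p n t -> moderate w p n (s t).
Proof.
move=> hs mt; rewrite /moderate -(rmorph_nat s) -rmorphXn -rmorphM.
by rewrite [_ \in _](fixes_small hens vw hK hs).
Qed.

(** Some endomorphism agrees with [s] on [K(th')] and acts trivially on the
    residues of [x] and [y]; it is found by first moving [th] to the root of
    [A - c] that corresponds to [s th'] under translation by [y]. *)
Lemma twin_fixed_mod s x : fixes (range iota) s -> x \in O -> M' x -> s x - x \in m.
Proof.
move=> hs xO M'x; pose t := s th' - y.
have ty : t + y = s th' by rewrite subrK.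
have Ast : A (s th') = iota (c + d).
  by rewrite -conj_addpoly // Ath'; apply: hs; exists (c + d).
have mst := moderate_conj hs mth'.
have mt : moderate w p n t by apply: moderateD => //; rewrite rpredN.
(* [A t = A (s th') - A y] up to [m], which is [c + d - d]. *)
have [|z Az tz] := addpoly_root_near p_pr bn (t := t) (b := iota c).
  have [e em] := addpolyD p_pr p_small bO mt yO; rewrite ty Ast => E.
  have -> : A t = iota c + iota d - A y - y * e by rewrite -[_ + iota d]rmorphD E; ring.
  have -> : iota c + iota d - A y - y * e - iota c = - (A y - iota d) - y * e by ring.
  by rewrite rpredB ?rpredN // smallMl.
have [r hr rth] := conj_th Az.
have [q hq [rqx rqy]] := lift_residues algF charK hens vw hM hr
  (purely_wild_fixed_mod wildM hr) xO yO.
have hqK : fixes (range iota) q by apply: fixes_sub hq; case: hM.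
pose i : {rmorphism F -> F} := r \o q.
have hi : fixes (range iota) i by apply: fixes_comp.
have ith : i th = z by rewrite /= hq //; apply: mem_adjoin.
(* Both are roots of [A - c - d], at the small distance
   [(i y - y) - (t - z)]. *)
have ith' : i th' = s th'.
  apply/eqP; rewrite -subr_eq0; apply/eqP.
  apply: (addpoly_inj_small p_pr p_small bO b0 mst).
    rewrite -{1}thy rmorphD ith -ty.
    have -> : z + i y - (t + y) = (i y - y) - (t - z) by ring.
    by rewrite rpredB.
  rewrite addrC subrK -conj_addpoly // Ath' Ast; apply: hi; by exists (c + d).
have M's : (M' `<=` [set x | i x = s x])%classic.
  by apply: adjoin_sub => //; apply: subext_agree.
by rewrite -(M's x M'x).
Qed.

Let S := subfield_pred hM.

(** Reduction modulo the orbit polynomial of [y] bounds the degree; that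
    polynomials in [y] form a field containing [th' = th + y] is [subring_inv]. *)
Lemma twin_horner r : uniq r ->
  (forall z, z \in r <-> exists2 s, fixes M s & z = s y) ->
  forall x, M' x ->
    exists P, [/\ P \is a polyOver S, (size P <= size r)%N & P.[y] = x].
Proof.
move=> ur hr x M'x; pose g := \prod_(z <- r) ('X - z%:P).
have gM : g \is a polyOver S by apply: (conj_poly_polyOver algF charK hM ur hr).
have gm : g \is monic by apply: monic_prod_XsubC.
have gy : g.[y] = 0.
  have yr : y \in r by apply/hr; exists idfun.
  by rewrite horner_prod (big_rem y) //= hornerXsubC subrr mul0r.
suff [Q QS <-] : exists2 Q, Q \is a polyOver S & Q.[y] = x.
  have [Q1 [P [_ PS sP ->]]] := polyOver_rem_monic gm gM QS.
  exists P; split=> //; last by rewrite hornerD hornerM gy mulr0 add0r.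
  by move: sP; rewrite size_prod_XsubC ltnS.
pose N := [set z | exists2 Q, Q \is a polyOver S & Q.[y] = z]%classic.
have SP z : z \in S <-> M z by split=> [/set_mem|/mem_set].
have NS z : z \in S -> N z by move=> zS; exists z%:P; rewrite ?polyOverC ?hornerC.
have hN : subring_closed [in N].
  split=> [|_ _ /set_mem[P PS <-] /set_mem[Q QS <-]|_ _ /set_mem[P PS <-] /set_mem[Q QS <-]];
    apply/mem_set.
  - by apply: NS; apply: rpred1.
  - by exists (P - Q); rewrite ?rpredB // hornerD hornerN.
  - by exists (P * Q); rewrite ?rpredM // hornerM.
have NK k : N (iota k) by apply/NS/SP; case: hM => _; apply; exists k.
have Ninv : {in subring_pred hN, forall z, z^-1 \in subring_pred hN}.
  by apply: (subring_inv algF) => k; apply/mem_set.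
have : (M' `<=` N)%classic; last by apply.
apply: adjoin_sub.
  split; last by move=> _ [k _ <-].
  have [h1 hB hMul] := hN; split=> // z t Nz Nt; apply: hMul => //; exact: Ninv.
have -> : th' = ('X + th%:P).[y] by rewrite hornerD hornerX hornerC addrC thy.
exists ('X + th%:P) => //; rewrite polyOverXaddC; apply/SP; exact: mem_adjoin.
Qed.

(** Two conjugates [s y] and [t y] with the same residue would give two roots
    [s th'] and [t th'] of [A - c - d] at a small distance. *)
Lemma twin_conj_separated s t : fixes M s -> fixes M t -> s y - t y \in m -> s y = t y.
Proof.
move=> hs ht st; apply/eqP; rewrite -subr_eq0; apply/eqP.
have KM : (range iota `<=` M)%classic by case: hM.
have hsK := fixes_sub KM hs; have htK := fixes_sub KM ht.
have conjA u : fixes M u -> u th' = th + u y /\ A (u th') = iota (c + d).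
  move=> hu; rewrite -{1}thy rmorphD hu; last exact: mem_adjoin.
  split=> //; rewrite -conj_addpoly ?Ath'; last exact: fixes_sub KM hu.
  by apply: (fixes_sub KM hu); exists (c + d).
have [es As] := conjA _ hs; have [et At] := conjA _ ht.
apply: (addpoly_inj_small p_pr p_small bO b0 (moderate_conj htK mth')) => //.
have -> : t th' + (s y - t y) = s th' by rewrite es et; ring.
by rewrite As.
Qed.

Lemma twin_small_coefs r (Q : {poly F}) : uniq r ->
  (forall z, z \in r <-> exists2 s, fixes M s & z = s y) ->
  Q \is a polyOver O -> (size Q <= size r)%N ->
  (forall s, fixes M s -> Q.[s y] \in m) -> forall i, Q`_i \in m.
Proof.
move=> ur hr QO sQ Qs; apply: (small_coefs QO _ ur) => //.
- by move=> z /hr [s hs ->]; rewrite (fixes_in_valring hens vw hM hs).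
- by move=> _ _ /hr [s hs ->] /hr [t ht ->]; apply: twin_conj_separated.
- by move=> z /hr [s hs ->]; apply: Qs.
Qed.

Lemma conj_horner s (P : {poly F}) z : fixes M s -> P \is a polyOver S ->
  P.[s z] = s P.[z].
Proof.
move=> hs /polyOverP PS; rewrite -horner_map; congr _.[_]; apply/polyP => i.
by rewrite coef_map /= hs //; apply/set_mem/PS.
Qed.

(** Divide a polynomial representing [x] by a coefficient of least value.  The
    primitive quotient cannot be small at [y]: it would be small at all
    conjugates of [y], and then have small coefficients. *)
Lemma twin_primitive x r : uniq r ->
  (forall z, z \in r <-> exists2 s, fixes M s & z = s y) -> M' x -> x != 0 ->
  exists z P, [/\ M z, P \is a polyOver S, P \is a polyOver O,
    (size P <= size r)%N & w P.[y] = 0 /\ x = z * P.[y]].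
Proof.
move=> ur hr M'x x0; have [P [PS sP Px]] := twin_horner ur hr M'x.
have [|z [zP z0 hz]] := @max_coef _ _ w P.
  have P0 : P != 0 by apply: contra_neq x0 => P0; rewrite -Px P0 horner0.
  apply/hasP; exists (lead_coef P); last by rewrite lead_coef_eq0.
  by rewrite lead_coefE mem_nth // prednK // size_poly_gt0.
have zS : z \in S by have /(nthP 0)[i _ <-] := zP; exact: (polyOverP PS).
pose Q := z^-1 *: P; have QS : Q \is a polyOver S by rewrite polyOverZ ?rpredV.
have QO : Q \is a polyOver O.
  apply/polyOverP => i; rewrite coefZ mulrC; have [iP|iP] := ltnP i (size P).
    by apply: hz; apply: mem_nth.
  by rewrite nth_default // mul0r rpred0.
exists z, Q; split=> //; first exact: set_mem zS.
  by rewrite size_scale ?invr_eq0.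
split; last by rewrite hornerZ mulVKf.
apply/val0P; split; first exact: (rpred_horner QO).
apply/negP => Qy; have /(nthP 0)[i iP iz] := zP.
have : Q`_i \in m.
  apply: (twin_small_coefs ur hr QO); first by rewrite size_scale ?invr_eq0.
  by move=> s hs; rewrite conj_horner // (fixes_small hens vw hM hs).
by rewrite coefZ iz mulVf // (negPf (one_notin_small w)).
Qed.

(** For residues, take [x = z * P.[y]] integral.  The polynomial [z *: P - x] is
    small at all conjugates of [y], since [x] is congruent to its conjugates; so
    its constant coefficient is small, and [x] has the residue of [z * P`_0]. *)
Lemma twin_bounded V (R : set (residue w)) :
  bounded iota V R M -> bounded iota V R M'.
Proof.
move=> [_ hV hR]; have [r [ur hr]] := conj_seq algF y hM.
split; first exact: subext_adjoin.
  move=> g [x M'x xg]; apply: hV.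
  have x0 : x != 0 by apply: contra_eq_neq xg => ->; rewrite Defs.val0.
  have [z [P [Mz _ _ _ [Py xE]]]] := twin_primitive ur hr M'x x0.
  by exists z => //; rewrite -xg xE Defs.valM Py addr0.
move=> _ [x [M'x xO] <-]; apply: hR.
have [->|x0] := eqVneq x 0.
  exists 0 => //; split; last by rewrite Defs.val0.
  by apply/set_mem; apply: (rpred0 S).
have [z [P [Mz PS PO sP [Py xE]]]] := twin_primitive ur hr M'x x0.
have zO : z \in O by move: xO; rewrite xE Defs.valM Py addr0.
(* At a conjugate [s y] this takes the value [s x - x], which is small. *)
pose Q := z *: P - x%:P.
have Q0 : Q`_0 \in m.
  apply: (twin_small_coefs ur hr).
  - by rewrite rpredB ?polyOverZ ?polyOverC.
  - rewrite (leq_trans (size_polyD _ _)) // geq_max size_polyN.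
    rewrite (leq_trans (size_scale_leq _ _)) // (leq_trans (size_polyC_leq1 _)) //.
    by rewrite lt0n size_eq0; apply/eqP => r0; have : y \in r by [apply/hr; exists idfun]; rewrite r0.
  - move=> s hs; rewrite /Q hornerD hornerN hornerC hornerZ conj_horner //.
    rewrite -{1}(hs z Mz) -rmorphM -xE; apply: twin_fixed_mod => //.
    by apply: fixes_sub hs; case: hM.
have zPS : z * P`_0 \in S by rewrite rpredM ?(polyOverP PS) //; apply/mem_set.
have zPO : z * P`_0 \in O by rewrite rpredM ?(polyOverP PO).
exists (z * P`_0); first by split=> //; apply: set_mem zPS.
apply/esym/resP => //; rewrite -rpredN opprB.
by move: Q0; rewrite coefB coefZ coefC.
Qed.

Lemma res_addpoly z : z \in O ->
  res w (A z) = \sum_i res w (b i) * res w z ^+ (p ^ i).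
Proof.
move=> zO; rewrite res_sum => [|i]; last by rewrite rpredM ?rpredX.
by apply: eq_bigr => i _; rewrite resM ?rpredX // resX.
Qed.

(** As [A y] is congruent to [d], the residue of [y] satisfies an additive
    equation over the residue field of [K] with unit linear coefficient, to
    which [additive_root_descent] applies. *)
Lemma twin_residue_root L : subext iota L ->
  (forall r : residue w, residue_field L r ->
     exists e, residue_field (range iota) (r ^+ (p ^ e)%N)) ->
  L th -> L th' -> exists2 k, k \in in_valring v & A (iota k) - iota d \in m.
Proof.
move=> hL hR Lth Lth'; pose T := subring_pred (residue_field_subring w hK).
have kT k : k \in in_valring v -> res w (iota k) \in T.
  move=> kO; apply/mem_set; exists (iota k) => //.
  by split; [exists k|rewrite -[(_ <= _)%O]/(_ \in O) (ext_in_valring vw)].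
have Ly : y \in subfield_pred hL by rewrite rpredB //; apply/mem_set.
have [|e re] := hR (res w y); first by exists y => //; split=> //; apply/set_mem.
have AyE : res w (A y) = res w (iota d).
  apply/resP => //; last by rewrite (ext_in_valring vw).
  by rewrite rpred_sum // => i _; rewrite rpredM ?rpredX.
have [a0O a0m] := (val0P v (a ord0)).1 a0; have [a00 a0VO] := smallN_inv a0m.
have : res w y \in T.
  apply: (additive_root_descent pw (b := fun i => res w (b i)) (e := e)
    (g := res w (iota (a ord0)^-1))); rewrite ?kT //.
  - by move=> i; apply: kT.
  - rewrite -resM ?(ext_in_valring vw) // -rmorphM mulVf // rmorph1; exact: res1.
  - by rewrite -res_addpoly // AyE kT.
  - exact/mem_set.
move=> /set_mem[_ [[k _ <-] kO] ek]; exists k.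
  by rewrite -(ext_in_valring vw).
apply/resP; rewrite ?(ext_in_valring vw) //.
  by rewrite rpred_sum // => i _; rewrite rpredM ?rpredX.
by rewrite res_addpoly // ek -res_addpoly // AyE.
Qed.

End Twin.

(** * Non-isomorphic maximal extensions *)

(** Only morphisms on [L] are given, so evaluation has to be followed inside
    [L]. *)
Lemma val_isomorphic_horner (K F : fieldType) (iota : {rmorphism K -> F})
    (L : set F) (s : F -> F) (P : {poly K}) x : subext iota L ->
  {in L &, {morph s : x y / x + y}} -> {in L &, {morph s : x y / x * y}} ->
  (forall a, s (iota a) = iota a) -> L x ->
  (map_poly iota P).[x] \in L /\ s (map_poly iota P).[x] = (map_poly iota P).[s x].
Proof.
move=> hL sD sM sK Lx; pose S := subfield_pred hL.
have KS a : iota a \in S by apply/mem_set; apply: hL.2; exists a.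
have xS : x \in S by apply/mem_set.
elim/poly_ind: P => [|P c [PL IH]].
  by rewrite map_poly0 !horner0; split; [exact: (rpred0 S)|rewrite -(rmorph0 iota)].
rewrite rmorphD rmorphM /= map_polyX map_polyC !hornerMXaddC.
have PxL : (map_poly iota P).[x] * x \in L by exact: (@rpredM _ S).
split; first exact: (@rpredD _ S _ _ PxL (KS c)).
by rewrite sD ?sM ?IH ?sK //; apply: (KS c).
Qed.

Lemma polyOver_range (K F : fieldType) (iota : {rmorphism K -> F}) (Q : {poly F}) :
  Q \is a polyOver [in range iota] -> exists P, Q = map_poly iota P.
Proof.
move=> QK; have {QK} QK : Q \is a polyOver (subfield_pred (subext_range iota)) by [].
have /choice[f fE] i : exists k, iota k = Q`_i.
  by have /set_mem[k _ <-] := polyOverP QK i; exists k.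
exists (\poly_(i < size Q) f i); apply/polyP => i; rewrite coef_map coef_poly.
by case: ltnP => [_|sQ] /=; rewrite ?fE // nth_default // rmorph0.
Qed.

Lemma is_minpoly_conj (K : fieldType) (F : closedFieldType) (iota : {rmorphism K -> F})
    (f : {poly K}) t z : is_algebraic iota -> is_minpoly iota t f ->
  root (map_poly iota f) z ->
  exists2 s : {rmorphism F -> F}, fixes (range iota) s & s t = z.
Proof.
move=> algF [f0 /rootP ft minf] /rootP fz.
have [|s [hs st]] := subext_conj algF (x := t) (x' := z) (subext_range iota).
  move=> _ /polyOver_range[P ->] Pt; rewrite (divp_eq P f) rmorphD rmorphM /=.
  rewrite hornerD hornerM fz mulr0 add0r; suff -> : P %% f = 0 by rewrite map_poly0 horner0.
  apply/eqP; apply: contraT => Pf0; have := ltn_modp P f; rewrite f0 ltnNge minf //.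
  apply/rootP; move: Pt; rewrite {1}(divp_eq P f) rmorphD rmorphM /= hornerD hornerM.
  by rewrite ft mulr0 add0r.
by exists s.
Qed.

Lemma val_exp (F : fieldType) (G : oagType) (w : valuation F G) x k :
  w (x ^+ k) = w x *+ k.
Proof.
by elim: k => [|k IH]; rewrite ?expr0 ?Defs.val1 ?mulr0n // exprS Defs.valM IH mulrS.
Qed.

(* With [w theta] and [w p] in one ordered group, the inequality
   [w theta > - w p / p ^ n] of the divisible hull reads
   [0 < p ^ n * w theta + w p]. *)
Theorem theorem1p6 (K : fieldType) (G : oagType) (v : valuation K G)
    (Kac : closedFieldType) (iota : {rmorphism K -> Kac})
    (H : oagType) (w : valuation Kac H)
    (p n : nat) (a : 'I_n.+1 -> K) (c : K) (theta : Kac)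
    (A := \sum_(i < n.+1) a i *: 'X^(p ^ i) : {poly K}) :
  is_algebraic iota ->
  henselian iota v ->
  val_extends iota v w ->
  [pchar K] =i pred0 ->
  p \in [pchar (residue v)] ->
  purely_wild iota w p (adjoin iota theta) ->
  is_minpoly iota theta (A - c%:P) ->
  A \is a polyOver (in_valring v) ->
  v (a ord0) = 0 ->
  v (a ord_max) = 0 ->
  ((0 : withoo H) < w theta *+ (p ^ n)%N + w p%:R)%O ->
  ~ poly_closed (map_poly (res v) A) ->
  not_unique_maximal iota w (purely_wild iota w p) /\
  (immediate iota w (adjoin iota theta) ->
   not_unique_maximal iota w (immediate iota w)).
Proof.
move=> algF hens vw charK pv wildM minth AO a0 an wth nclosed.
have p_pr := pcharf_prime pv.
have aO i : a i \in in_valring v.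
  have := polyOverP AO (p ^ i)%N; rewrite coef_sum (bigD1 i) //= coefZ coefXn eqxx mulr1.
  rewrite big1 ?addr0 // => j ji; rewrite coefZ coefXn.
  rewrite eqn_exp2l ?prime_gt1 //; suff /negPf -> : (i != j :> nat) by rewrite mulr0.
  by rewrite eq_sym.
have AE z : (map_poly iota A).[z] = addpoly p (fun i => iota (a i)) z.
  rewrite rmorph_sum horner_sum; apply: eq_bigr => i _.
  by rewrite /= map_polyZ hornerZ map_polyXn hornerXn.
have rootE z b : root (map_poly iota (A - b%:P)) z <->
    addpoly p (fun i => iota (a i)) z = iota b.
  rewrite rmorphB /= map_polyC /= /root hornerD hornerN hornerC AE subr_eq0.
  by split=> /eqP.
have mth : moderate w p n theta by rewrite /moderate unfold_in Defs.valM val_exp.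
have Ath : addpoly p (fun i => iota (a i)) theta = iota c.
  by apply/rootE; case: minth.
have conj_th z : addpoly p (fun i => iota (a i)) z = iota c ->
    exists2 s : {rmorphism Kac -> Kac}, fixes (range iota) s & s theta = z.
  by move/rootE; apply: is_minpoly_conj minth.
have [d dO nd] : exists2 d, d \in in_valring v &
    forall k, k \in in_valring v -> A.[k] - d \notin small v.
  have [delta ndelta] : exists delta, forall x, (map_poly (res v) A).[x] <> delta.
    by move/existsNP: nclosed => [delta /forallNP ?]; exists delta.
  have dE : res v (val (repr delta)) = delta by rewrite res_val reprK.
  exists (val (repr delta)) => [|k kO]; first exact: valP.
  apply/negP => Akd; apply: (ndelta (res v k)); rewrite -res_horner // -dE.
  by apply/resP => //; [exact: (rpred_horner AO)|exact: valP].
have [th' Ath'] := addpoly_surj p_pr (ext_val0 vw an) (iota (c + d)) : exists s,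
  addpoly p (fun i => iota (a i)) s = _.
have main V (R : set (residue w)) :
    (R `<=` [set r | exists e, residue_field (range iota) (r ^+ (p ^ e)%N)])%classic ->
    bounded iota V R (adjoin iota theta) -> not_unique_maximal iota w (bounded iota V R).
  move=> Rp bM.
  have bM' := twin_bounded algF charK hens vw pv aO a0 an mth Ath conj_th wildM dO Ath' bM.
  have [L [maxL ML]] := bounded_maximal bM; have [L' [maxL' ML']] := bounded_maximal bM'.
  (* An isomorphism from [L] would pull [th'] back to a root of [A - c - d] in
     [L], next to [theta]. *)
  exists L, L'; split=> // -[s [[_ sinj ssurj] sD sM sK _]].
  have [x Lx sx] := ssurj _ (ML' _ (@mem_adjoin _ _ iota th')).
  have [[hL _ hR] _] := maxL.
  have hx := val_isomorphic_horner A hL sD sM sK Lx.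
  have Ax : addpoly p (fun i => iota (a i)) x = iota (c + d).
    rewrite -AE; apply: sinj; [exact: hx.1| |by rewrite hx.2 sx AE Ath' sK].
    by apply/mem_set; case: hL => _; apply; exists (c + d).
  have [||k kO kd] := twin_residue_root vw pv aO a0 an mth Ath dO Ax hL _ _ Lx.
  - by move=> r /hR/Rp.
  - exact: ML (@mem_adjoin _ _ iota theta).
  have := nd k kO; rewrite -(ext_small vw) rmorphB /= -horner_map AE.
  by rewrite kd.
split.
  rewrite purely_wild_bounded; exact: main.
rewrite immediate_bounded; apply: main.
by move=> r Kr; exists 0%N; rewrite expn0 expr1.
Qed.
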